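(* For infinite time Turing machines, $\mathrm{P}\neq\mathrm{NP}\cap\mathrm{co}\text{-}\mathrm{NP}$; in particular $\mathrm{P}\neq\mathrm{NP}$.
   Context: $\mathbb{R}=2^\omega$. Infinite time Turing machines (ITTMs): three binary tapes indexed by $\omega$, finite program with start, limit, halt states; ordinary Turing operation at successor stages; at limit stages the limit state is entered, the head returns to the leftmost cell, and each cell takes the $\limsup$ of its earlier values. A set $A\subseteq\mathbb{R}$ is in $\mathrm{P}$ if there are a program $p$ and $n\in\omega$ such that $p$ decides $A$ and halts on every input in fewer than $\omega^n$ steps. $A$ is in $\mathrm{NP}$ if there are a program $p$ and $n\in\omega$ such that $p$ halts on every input pair $(x,y)$ in fewer than $\omega^n$ steps and $x\in A$ iff there exists $y\in\mathbb{R}$ such that $p$ accepts $(x,y)$. $\mathrm{co}\text{-}\mathrm{NP}$ is the class of complements $\mathbb{R}\setminus A$ of sets $A\in\mathrm{NP}$. *)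

(* Defs.v *)
(* infinite time Turing machines, with time
   stages below omega^omega represented as lexicographically ordered
   tuples of naturals (Cantor normal form, most significant first). *)
From HB Require Import structures.
From mathcomp Require Import all_boot.
Set Implicit Arguments. Unset Strict Implicit. Unset Printing Implicit Defensive.

Definition real := nat -> bool.

Definition pairR (x y : real) : real :=
  fun k => if odd k then y k./2 else x k./2.

(* An ITTM program: finitely many states (a finType), distinguished start,
   limit and halt states, and a transition function reading the three
   cells under the head and returning new state, three written bits and a
   move (true = right, false = left). *)
Record Prog := {
  St : finType;
  start_st : St;
  limit_st : St;
  halt_st : St;
  delta : St -> bool * bool * bool -> St * (bool * bool * bool) * bool
}.

Record Config (p : Prog) := {
  cst : St p;
  chead : nat;
  tape1 : real;   (* input tape *)
  tape2 : real;   (* scratch tape *)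
  tape3 : real    (* output tape *)
}.

Definition upd (t : real) (h : nat) (b : bool) : real :=
  fun k => if k == h then b else t k.

(* One ordinary Turing step; a halted machine stays put. Moving left from
   cell 0 leaves the head at cell 0. *)
Definition step (p : Prog) (c : Config p) : Config p :=
  if cst c == halt_st p then c else
  let h := chead c in
  let: (q', (w1, w2, w3), mv) := delta (cst c) (tape1 c h, tape2 c h, tape3 c h) in
  {| cst := q'; chead := if mv then h.+1 else h.-1;
     tape1 := upd (tape1 c) h w1; tape2 := upd (tape2 c) h w2;
     tape3 := upd (tape3 c) h w3 |}.

Definition init (p : Prog) (x : real) : Config p :=
  {| cst := start_st p; chead := 0; tape1 := x;
     tape2 := fun _ => false; tape3 := fun _ => false |}.

(* Ordinals below omega^n: sequences of length n, s = [c_{n-1}; ...; c_0]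
   standing for omega^(n-1) c_{n-1} + ... + c_0, compared lexicographically. *)
Fixpoint lexlt (s t : seq nat) : bool :=
  match s, t with
  | a :: s', b :: t' => (a < b) || ((a == b) && lexlt s' t')
  | _, _ => false
  end.

Definition lexle (s t : seq nat) : bool := (s == t) || lexlt s t.

Definition is_zero (s : seq nat) : bool := all (fun a => a == 0) s.

(* successor: increment the last (omega^0) coefficient *)
Fixpoint incr_last (s : seq nat) : seq nat :=
  match s with
  | [::] => [::]
  | [:: a] => [:: a.+1]
  | a :: s' => a :: incr_last s'
  end.

Definition is_limit (s : seq nat) : bool := ~~ is_zero s && (last 0 s == 0).

Definition limsup_before (n : nat) (f : seq nat -> bool) (a : seq nat) : Prop :=
  forall b, size b = n -> lexlt b a ->
    exists g, [/\ size g = n, lexle b g, lexlt g a & f g = true].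

Definition run (p : Prog) (x : real) (n : nat) (r : seq nat -> Config p) : Prop :=
  [/\ forall a, size a = n -> is_zero a -> r a = init p x,
      forall a, size a = n -> 0 < n -> r (incr_last a) = step (r a)
    & forall a, size a = n -> is_limit a ->
        [/\ cst (r a) = limit_st p, chead (r a) = 0
          & forall k,
            (tape1 (r a) k = true <-> limsup_before n (fun g => tape1 (r g) k) a) /\
            (tape2 (r a) k = true <-> limsup_before n (fun g => tape2 (r g) k) a) /\
            (tape3 (r a) k = true <-> limsup_before n (fun g => tape3 (r g) k) a)]].

Arguments run : clear implicits.
Arguments init : clear implicits.

Definition HaltsWith (p : Prog) (n : nat) (x : real) (b : bool) : Prop :=
  exists r, run p x n r /\
    exists a, [/\ size a = n, cst (r a) = halt_st p,
                  (forall g, size g = n -> lexlt g a -> cst (r g) <> halt_st p)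
                & tape3 (r a) 0 = b].

Definition inP (A : real -> Prop) : Prop :=
  exists (p : Prog) (n : nat), forall x, exists b, HaltsWith p n x b /\ (b = true <-> A x).

Definition inNP (A : real -> Prop) : Prop :=
  exists (p : Prog) (n : nat),
    (forall x y, exists b, HaltsWith p n (pairR x y) b) /\
    (forall x, A x <-> exists y, HaltsWith p n (pairR x y) true).

Definition incoNP (A : real -> Prop) : Prop :=
  exists B, inNP B /\ forall x, A x <-> ~ B x.

(* Main.v *)
(** The separating set is the set of reals [e] coding an infinitary NOR circuit
    whose root gate outputs [true]. A real codes which gates are wired to which,
    and a row of bits per gate; a wire counts only if it descends in a
    lexicographic order of these rows that is well-founded for every [e] and has
    the order types of all ordinals below omega^omega. Hence every circuit has
    exactly one consistent valuation of its gates, and "the root is [true]" and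
    "the root is [false]" are complementary and both witnessed by that valuation.

    Whether a given valuation [y] is consistent is a "for all, there is"
    condition on [(e, y)]. A counter machine searches for the witnesses one after
    the other and flashes output cell 0 after each success; by the limsup rule
    the cell shows [true] at time omega iff all witnesses were found, so the
    verification takes omega + 1 steps.

    Conversely, the run of a program for omega^n steps is computed stage by
    stage by such a circuit. Wiring a copy of every bit of [e] into [e] itself at
    a later position yields, for each program, a circuit that outputs [true] iff
    the program rejects the code of that circuit. *)
Require Import Defs.
From HB Require Import structures.
From mathcomp Require Import all_boot.
From mathcomp Require Import boolp zify.
Set Implicit Arguments. Unset Strict Implicit. Unset Printing Implicit Defensive.

(** * Counter programs on an infinite time Turing machine *)

(* The tapes are cut into blocks of [K] cells. Register [i], with [4 <= i < K],
   holds [a] when tape 2 carries a mark in cell [K * a + i]; the first four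
   cells of block [a] of tape 1 are the input bits that can be queried at
   address [a]. Tape 3 has a mark in cell 1, by which the head finds its way
   back, and cell 0 of tape 3 is raised for one step by [IFlash]. *)
Notation K := 20.

Inductive instr :=
| IInc of nat & nat
| IDec of nat & nat
| IJz of nat & nat & nat
| IQry of nat & nat & nat & nat
| IFlash of nat.

Definition ijump l := IJz 4 l l.

Section Hardware.
Variable code : seq instr.
Let L := size code.

(** [Init] lays out the marks; [Scan l r f] runs right in search of the register of instruction [l],
    where [r] is the position mod [K] and [f] says that the head is still in block 0; [Mov] carries
    a mark to a neighbouring block; [Look] walks to a queried cell; [Ret] returns to the end mark;
    [Fl] lowers a flash. *)
Inductive mst :=
| Init of 'I_K
| Scan of 'I_L.+1 & 'I_K & bool
| Mov of bool & 'I_L.+1 & 'I_K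
| Look of 'I_L.+1 & 'I_L.+1 & 'I_K
| Ret of 'I_L.+1
| Fl of 'I_L.+1
| Lim
| Hlt.

Definition mst_enc (s : mst) : 'I_K + 'I_L.+1 * 'I_K * bool
    + bool * 'I_L.+1 * 'I_K + 'I_L.+1 * 'I_L.+1 * 'I_K + 'I_L.+1 * bool + bool :=
  match s with
  | Init r => inl (inl (inl (inl (inl r))))
  | Scan l r f => inl (inl (inl (inl (inr (l, r, f)))))
  | Mov d l k => inl (inl (inl (inr (d, l, k))))
  | Look l l' k => inl (inl (inr (l, l', k)))
  | Ret l => inl (inr (l, true))
  | Fl l => inl (inr (l, false))
  | Lim => inr true
  | Hlt => inr false
  end.

Definition mst_dec s : mst :=
  match s with
  | inl (inl (inl (inl (inl r)))) => Init r
  | inl (inl (inl (inl (inr (l, r, f))))) => Scan l r f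
  | inl (inl (inl (inr (d, l, k)))) => Mov d l k
  | inl (inl (inr (l, l', k))) => Look l l' k
  | inl (inr (l, true)) => Ret l
  | inl (inr (l, false)) => Fl l
  | inr true => Lim
  | inr false => Hlt
  end.

Lemma mst_encK : cancel mst_enc mst_dec.
Proof. by case. Qed.

HB.instance Definition _ := Finite.copy mst (can_type mst_encK).

(** [Look] leaves to the right because the queried cell can be cell 0, from which [Ret] would miss
    the end mark in cell 1. [Lim] halts without changing the tapes, so the output is the limsup of
    output cell 0. *)
Definition mdelta (s : mst) (b : bool * bool * bool) :
    mst * (bool * bool * bool) * bool :=
  let: (b1, b2, b3) := b in
  match s with
  | Init r => (if r == 19 :> nat then Ret ord0 else Init (inord r.+1),
               (b1, 4 <= r, r == 1 :> nat), true)
  | Scan l r f =>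
    let at_mark i act :=
      if (r == i :> nat) && b2 then act
      else (Scan l (inord (r.+1 %% K)) (f && (r.+1 < K)), b, true) in
    match nth (ijump 0) code l with
    | IFlash l' => (Fl (inord l'), (b1, b2, true), false)
    | IInc i l' => at_mark i (Mov true (inord l') (inord 19), (b1, false, b3), true)
    | IDec i l' =>
      at_mark i (if f then (Ret (inord l'), b, false)
                 else (Mov false (inord l') (inord 19), (b1, false, b3), false))
    | IJz i l0 l1 => at_mark i (Ret (inord (if f then l0 else l1)), b, false)
    | IQry o i l1 l0 => at_mark i (Look (inord l1) (inord l0) (inord (i - o.+1)), b, false)
    end
  | Mov d l k => if k == 0 :> nat then (Ret l, (b1, true, b3), false)
                 else (Mov d l (inord k.-1), b, d)
  | Look l1 l0 k => if k == 0 :> nat then (Ret (if b1 then l1 else l0), b, true)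
                    else (Look l1 l0 (inord k.-1), b, false)
  | Ret l => (if b3 then Scan l ord0 true else Ret l, b, false)
  | Fl l => (Scan l ord0 true, (b1, b2, false), false)
  | Lim => (Hlt, b, true)
  | Hlt => (Hlt, b, true)
  end.

Definition mprog : Prog :=
  {| St := mst; start_st := Init ord0; limit_st := Lim; halt_st := Hlt; delta := mdelta |}.

Definition mk (s : mst) h t1 t2 t3 : Config mprog :=
  @Build_Config mprog s h t1 t2 t3.

Lemma upd_id (t : real) h : upd t h (t h) = t.
Proof. by apply: funext => k; rewrite /upd; case: eqP => // ->. Qed.

Lemma stepE s h t1 t2 t3 : s != Hlt ->
  step (mk s h t1 t2 t3) =
  let: (q, (w1, w2, w3), mv) := mdelta s (t1 h, t2 h, t3 h) in
  mk q (if mv then h.+1 else h.-1) (upd t1 h w1) (upd t2 h w2) (upd t3 h w3).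
Proof. by move=> sH; rewrite /step /= (negPf sH). Qed.

(* [go m f c c']: the machine goes from [c] to [c'] in [m] steps without
   halting, and [f] tells whether output cell 0 shows [true] on the way. *)
Inductive go : nat -> bool -> Config mprog -> Config mprog -> Prop :=
| go0 (c : Config mprog) : go 0 false c c
| goS m f (c c' : Config mprog) : cst c != halt_st mprog -> go m f (step c) c' -> go m.+1 (tape3 c 0 || f) c c'.

Lemma go_trans m1 m2 f1 f2 c1 c2 c3 :
  go m1 f1 c1 c2 -> go m2 f2 c2 c3 -> go (m1 + m2) (f1 || f2) c1 c3.
Proof.
by elim=> // m f c c' cH _ IH /IH h; rewrite addSn -orbA; apply: goS.
Qed.

Lemma go_step s h t1 t2 t3 c m f : s != Hlt -> t3 0 = false ->
  go m f (let: (q, (w1, w2, w3), mv) := mdelta s (t1 h, t2 h, t3 h) in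
  mk q (if mv then h.+1 else h.-1) (upd t1 h w1) (upd t2 h w2) (upd t3 h w3)) c ->
  go m.+1 f (mk s h t1 t2 t3) c.
Proof.
move=> sH t30 g; rewrite -[f]/(false || f) -t30; apply: (@goS _ _ (mk s h t1 t2 t3)) => //.
by rewrite stepE.
Qed.

Definition reach f c c' := exists m, go m f c c'.

Lemma reach_trans f1 f2 c1 c2 c3 :
  reach f1 c1 c2 -> reach f2 c2 c3 -> reach (f1 || f2) c1 c3.
Proof. by move=> [m1 g1] [m2 g2]; exists (m1 + m2); apply: go_trans g1 g2. Qed.

Definition memory := nat -> nat.
Definition set (s : memory) i v : memory := fun j => if j == i then v else s j.

Definition marks (s : memory) : real :=
  fun k => (4 <= k %% K) && (s (k %% K) == k %/ K).
Definition endmark : real := fun k => k == 1.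

Definition cfg (x : real) l (s : memory) :=
  mk (Scan (inord l) ord0 true) 0 x (marks s) endmark.

Lemma go_ret h l x t2 : 0 < h ->
  go h false (mk (Ret l) h x t2 endmark) (mk (Scan l ord0 true) 0 x t2 endmark).
Proof.
elim: h => // h IH _; apply: go_step => //=; rewrite !upd_id.
case: h IH => [|h] IH; first exact: go0.
by apply: IH.
Qed.

Lemma go_mov_right l k : forall h x t2, k < K ->
  go k false (mk (Mov true l (inord k)) h x t2 endmark)
     (mk (Mov true l (inord 0)) (h + k) x t2 endmark).
Proof.
elim: k => [|k IH] h x t2 kK; first by rewrite addn0; apply: go0.
apply: go_step => //=; rewrite inordK //= !upd_id addnS -addSn; apply: IH; exact: ltnW.
Qed.

Lemma go_mov_left l k : forall h x t2, k < K -> k <= h ->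
  go k false (mk (Mov false l (inord k)) h x t2 endmark)
     (mk (Mov false l (inord 0)) (h - k) x t2 endmark).
Proof.
elim: k => [|k IH] h x t2 kK kh; first by rewrite subn0; apply: go0.
apply: go_step => //=; rewrite inordK //= !upd_id.
have -> : h - k.+1 = h.-1 - k by lia.
apply: IH; lia.
Qed.

Lemma go_look l1 l0 k : forall h x t2, k < K -> k <= h ->
  go k false (mk (Look l1 l0 (inord k)) h x t2 endmark)
     (mk (Look l1 l0 (inord 0)) (h - k) x t2 endmark).
Proof.
elim: k => [|k IH] h x t2 kK kh; first by rewrite subn0; apply: go0.
apply: go_step => //=; rewrite inordK //= !upd_id.
have -> : h - k.+1 = h.-1 - k by lia.
apply: IH; lia.
Qed.

Definition reg (I : instr) :=
  match I with
  | IInc i _ | IDec i _ | IJz i _ _ | IQry _ i _ _ => i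
  | IFlash _ => 0
  end.

(** Among the cells of residue [reg I] only the one at address [s (reg I)] is marked, so nothing
    stops the head earlier. *)
Lemma go_scan x l s j :
  let I := nth (ijump 0) code l in
  l <= L -> 4 <= reg I -> j <= K * s (reg I) + reg I -> reg I < K ->
  go j false (cfg x l s)
     (mk (Scan (inord l) (inord (j %% K)) (j < K)) j x (marks s) endmark).
Proof.
move=> I lL rI; elim: j => [|j IH] jle rK.
  have e0 : ord0 = inord (0 %% K) :> 'I_K by apply/val_inj; rewrite /= inordK.
  by rewrite /cfg {1}e0; apply: go0.
rewrite -addn1 -[false]orbF; apply: go_trans (IH _ _) _ => //; first exact: ltnW.
apply: go_step => //; have -> : mdelta (Scan (inord l) (inord (j %% K)) (j < K))
    (x j, marks s j, endmark j) =
    (Scan (inord l) (inord (j.+1 %% K)) (j.+1 < K), (x j, marks s j, endmark j), true).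
  have nI : (j %% K == reg I) && marks s j = false.
    apply/negbTE/negP => /andP[/eqP jr]; rewrite /marks jr => /andP[_ /eqP sj].
    by move: jle; rewrite sj; lia.
  have jK : (inord (j %% K) : 'I_K) = j %% K :> nat by rewrite inordK //; lia.
  have e1 : ((j %% K).+1 %% K) = j.+1 %% K by lia.
  have e2 : (j < K) && ((j %% K).+1 < K) = (j.+1 < K) by lia.
  rewrite /= inordK // jK e1 e2; move: nI rI; rewrite /I.
  by case: (nth _ _ _) => [i l'|i l'|i l0 l1|o i l1 l0|l'] //= -> .
by rewrite !upd_id; rewrite addn1; apply: go0.
Qed.

Lemma marks_at s i : 4 <= i -> i < K -> marks s (K * s i + i).
Proof.
move=> i4 iK; rewrite /marks.
have -> : (K * s i + i) %% K = i by lia.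
have -> : (K * s i + i) %/ K = s i by lia.
by rewrite i4 eqxx.
Qed.

Lemma marks_set s i v : 4 <= i -> i < K ->
  upd (upd (marks s) (K * s i + i) false) (K * v + i) true = marks (set s i v).
Proof.
move=> i4 iK; apply: funext => k; rewrite /upd /marks /set.
have [->|kv] := eqVneq k (K * v + i).
  have -> : (K * v + i) %% K = i by lia.
  have -> : (K * v + i) %/ K = v by lia.
  by rewrite i4 !eqxx.
case: (eqVneq (k %% K) i) => [ki|ki].
  have kE := divn_eq k K; rewrite ki in kE.
  rewrite ki i4 /=; have -> : (v == k %/ K) = false.
    by apply/negbTE/eqP => vE; move/eqP: kv; rewrite vE; lia.
  by case: (eqVneq k (K * s i + i)) => // ks; apply/negbTE/eqP => sE; move/eqP: ks; rewrite sE; lia.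
case: (eqVneq k (K * s i + i)) => [ks|//]; exfalso; move/eqP: ki; lia.
Qed.

Definition instr_ok I := match I with
  | IFlash _ => true
  | IQry o i _ _ => [&& o < 4, 4 <= i & i < K]
  | J => (4 <= reg J) && (reg J < K)
  end.

Definition sem (x : real) I (s : memory) : nat * memory :=
  match I with
  | IInc i l => (l, set s i (s i).+1)
  | IDec i l => (l, set s i (s i).-1)
  | IJz i l0 l1 => (if s i == 0 then l0 else l1, s)
  | IQry o i l1 l0 => (if x (K * s i + o) then l1 else l0, s)
  | IFlash l => (l, s)
  end.

Definition flashes I := if I is IFlash _ then true else false.

Lemma set_id s i : set s i (s i) = s.
Proof. by apply: funext => k; rewrite /set; case: eqP => // ->. Qed.

Lemma mod_pos a i : i < K -> (K * a + i) %% K = i. Proof. lia. Qed.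

Lemma go_found x l s : let I := nth (ijump 0) code l in
  l <= L -> instr_ok I -> ~~ flashes I -> let i := reg I in let P := K * s i + i in
  exists2 m, 0 < m & go m false
     (mk (Scan (inord l) (inord (P %% K)) (P < K)) P x (marks s) endmark)
     (cfg x (sem x I s).1 (sem x I s).2).
Proof.
move=> I lL ok nf i P.
have [i4 iK] : 4 <= i /\ i < K.
  by move: ok nf; rewrite /i; case: (I) => //= *; lia.
have mP : marks s P by apply: marks_at.
have P4 : 4 <= P by rewrite /P; lia.
have fP : (P < K) = (s i == 0) by rewrite /P; lia.
have PK : P %% K = i by apply: mod_pos.
have iok : (inord i : 'I_K) = i :> nat by rewrite inordK.
have uP : upd (marks s) P true = marks s by rewrite -{1}mP upd_id.
rewrite PK fP /cfg.
move: ok nf @P mP P4 fP PK iok i4 iK uP; rewrite /i /I.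
case EI : (nth _ _ _) => [j l'|j l'|j l0 l1|o j l1 l0|l'] //= ok _ mP P4 fP PK iok i4 iK uP.
- eexists; last first.
    apply: go_step => //=; rewrite inordK // EI iok eqxx mP /= !upd_id.
    rewrite -[false]orbF; apply: go_trans; first exact: go_mov_right.
    apply: go_step => //=; rewrite inordK //= !upd_id.
    have -> : (K * s j + j).+1 + 19 = K * (s j).+1 + j by lia.
    rewrite marks_set //; apply: go_ret; lia.
  by [].
(* A zero register keeps its mark, in accordance with [0.-1 = 0]. *)
- case: eqP => sj.
    eexists; last first.
      apply: go_step => //=; rewrite inordK // EI iok eqxx mP /= !upd_id.
      rewrite uP (_ : set s j _ = s); last by rewrite sj -[X in set _ _ X]sj set_id.
      by apply: go_ret; lia.
    by [].
  eexists; last first.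
    apply: go_step => //=; rewrite inordK // EI iok eqxx mP /= !upd_id.
    rewrite -[false]orbF; apply: go_trans; first by apply: go_mov_left; lia.
    apply: go_step => //=; rewrite inordK //= !upd_id.
    have -> : (K * s j + j).-1 - 19 = K * (s j).-1 + j by lia.
    rewrite marks_set //; apply: go_ret; lia.
  by [].
- eexists; last first.
    apply: go_step => //=; rewrite inordK // EI iok eqxx mP /= !upd_id uP.
    by rewrite (fun_if inord) -fun_if; apply: go_ret; lia.
  by [].
- have [o4] : o < 4 /\ 4 <= j by lia.
  eexists; last first.
    apply: go_step => //=; rewrite inordK // EI iok eqxx mP /= !upd_id uP.
    rewrite -[false]orbF; apply: go_trans; first by apply: go_look; lia.
    apply: go_step => //=; rewrite inordK //= !upd_id.
    have -> : (K * s j + j).-1 - (j - o.+1) = K * s j + o by lia.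
    have -> : (if x (K * s j + o) then inord l1 else inord l0) =
      inord (if x (K * s j + o) then l1 else l0) :> 'I_L.+1 by case: (x _).
    apply: go_ret; lia.
  by [].
Qed.

Lemma go_instr x l s : let I := nth (ijump 0) code l in
  l <= L -> instr_ok I ->
  exists2 m, 0 < m & go m (flashes I) (cfg x l s) (cfg x (sem x I s).1 (sem x I s).2).
Proof.
move=> I lL ok; case fI : (flashes I).
  move: ok fI; rewrite /I; case EI : (nth _ _ _) => [j l'|j l'|j l0 l1|o j l1 l0|l'] //= _ _.
  exists 2 => //; apply: go_step => //=; rewrite inordK // EI /= !upd_id.
  set c := mk _ _ _ _ _; rewrite -[true]/(tape3 c 0 || false); apply: goS => //.
  rewrite stepE //= !upd_id /cfg.
  have -> : upd (upd endmark 0 true) 0 false = endmark.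
    by apply: funext => -[|k].
  exact: go0.
have [i4 iK] : 4 <= reg I /\ reg I < K by move: ok fI; case: (I) => //= *; lia.
have [m m0 g] := go_found x s lL ok (negbT fI).
exists (K * s (reg I) + reg I + m); first by lia.
by rewrite -[false]orbF; apply: go_trans g; apply: go_scan.
Qed.

Lemma go_init x : exists2 m, 0 < m &
  go m false (init mprog x) (cfg x 0 (fun=> 0)).
Proof.
pose t2 j : real := fun k => (k < j) && (4 <= k).
pose t3 j : real := fun k => (k < j) && (k == 1).
have H j : j <= 19 -> go j false (init mprog x) (mk (Init (inord j)) j x (t2 j) (t3 j)).
  elim: j => [_|j IH jK].
    rewrite /init /=; have -> : Init ord0 = Init (inord 0) by congr Init; apply/val_inj; rewrite /= inordK.
    by apply: go0.
  rewrite -addn1 -[false]orbF; apply: go_trans; first by apply: IH; lia.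
  apply: go_step => //=; first by rewrite /t3; case: (j).
  rewrite inordK; last by lia.
  rewrite ifN; last by lia.
  rewrite upd_id addn1; set c := mk _ _ _ _ _; set c' := mk _ _ _ _ _.
  suff -> : c = c' by apply: go0.
  rewrite /c /c'; congr mk; apply: funext => k; rewrite /upd /t2 /t3; case: eqP => [->|]; lia.
(* Cells 0 to 18 take 19 steps, cell 19 one more, and 20 steps lead back to cell 0. *)
exists (19 + (1 + 20)) => //; rewrite -[false]orbF; apply: go_trans; first exact: H.
rewrite -[false]orbF; apply: go_trans.
  apply: go_step => //=; rewrite inordK //= upd_id; exact: go0.
have -> : upd (t3 19) 19 false = endmark.
  by apply: funext => k; rewrite /upd /t3 /endmark; case: eqP; lia.
have -> : upd (t2 19) 19 true = marks (fun=> 0).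
  by apply: funext => k; rewrite /upd /t2 /marks; case: eqP; lia.
have -> : cfg x 0 (fun=> 0) = mk (Scan ord0 ord0 true) 0 x (marks (fun=> 0)) endmark.
  by rewrite /cfg; congr (mk (Scan _ _ _)); apply/val_inj; rewrite /= inordK.
exact: go_ret.
Qed.

End Hardware.

(** * A while language *)

Inductive cmd :=
| CSkip
| CFlash
| CInc of nat
| CDec of nat
| CSeq of cmd & cmd
| CIfZ of nat & cmd & cmd
| CIfQ of nat & nat & cmd & cmd
| CWhile of nat & cmd.

Fixpoint compile (c : cmd) (p : nat) : seq instr :=
  match c with
  | CSkip => [::]
  | CFlash => [:: IFlash p.+1]
  | CInc i => [:: IInc i p.+1]
  | CDec i => [:: IDec i p.+1]
  | CSeq c1 c2 => let l1 := compile c1 p in l1 ++ compile c2 (p + size l1)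
  | CIfZ i c1 c2 =>
    let l1 := compile c1 p.+1 in let q := p.+1 + size l1 in let l2 := compile c2 q.+1 in
    IJz i p.+1 q.+1 :: l1 ++ ijump (q.+1 + size l2) :: l2
  | CIfQ o i c1 c2 =>
    let l1 := compile c1 p.+1 in let q := p.+1 + size l1 in let l2 := compile c2 q.+1 in
    IQry o i p.+1 q.+1 :: l1 ++ ijump (q.+1 + size l2) :: l2
  | CWhile i c =>
    let l := compile c p.+1 in
    IJz i (p.+1 + size l).+1 p.+1 :: rcons l (ijump p)
  end.

Fixpoint cmd_ok (c : cmd) : bool :=
  match c with
  | CSkip | CFlash => true
  | CInc i | CDec i => (4 <= i) && (i < K)
  | CSeq c1 c2 => cmd_ok c1 && cmd_ok c2
  | CIfZ i c1 c2 => [&& 4 <= i, i < K, cmd_ok c1 & cmd_ok c2]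
  | CIfQ o i c1 c2 => [&& o < 4, 4 <= i, i < K, cmd_ok c1 & cmd_ok c2]
  | CWhile i c => [&& 4 <= i, i < K & cmd_ok c]
  end.

(* The boolean tells whether a flash occurred. *)
Inductive exec (x : real) : cmd -> memory -> memory -> bool -> Prop :=
| XSkip s : exec x CSkip s s false
| XFlash s : exec x CFlash s s true
| XInc i s : exec x (CInc i) s (set s i (s i).+1) false
| XDec i s : exec x (CDec i) s (set s i (s i).-1) false
| XSeq c1 c2 s1 s2 s3 f1 f2 :
    exec x c1 s1 s2 f1 -> exec x c2 s2 s3 f2 -> exec x (CSeq c1 c2) s1 s3 (f1 || f2)
| XIfZ i c1 c2 s s' f :
    exec x (if s i == 0 then c1 else c2) s s' f -> exec x (CIfZ i c1 c2) s s' f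
| XIfQ o i c1 c2 s s' f :
    exec x (if x (K * s i + o) then c1 else c2) s s' f -> exec x (CIfQ o i c1 c2) s s' f
| XWhile0 i c s : s i = 0 -> exec x (CWhile i c) s s false
| XWhileS i c s1 s2 s3 f1 f2 : s1 i != 0 ->
    exec x c s1 s2 f1 -> exec x (CWhile i c) s2 s3 f2 -> exec x (CWhile i c) s1 s3 (f1 || f2).

Section Compile.
Variable code : seq instr.

Definition placed p l := exists pre post, code = pre ++ l ++ post /\ size pre = p.

Lemma placed_cat p l1 l2 :
  placed p (l1 ++ l2) -> placed p l1 /\ placed (p + size l1) l2.
Proof.
move=> [pre [post [eC <-]]]; split.
  by exists pre, (l2 ++ post); rewrite eC !catA.
by exists (pre ++ l1), post; rewrite eC !catA size_cat.
Qed.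

Lemma placed_cons p I l : placed p (I :: l) -> placed p [:: I] /\ placed p.+1 l.
Proof. by move/(@placed_cat _ [:: I]); rewrite addn1. Qed.

Lemma reach_instr x p I s : placed p [:: I] -> instr_ok I ->
  reach (flashes I) (cfg code x p s) (cfg code x (sem x I s).1 (sem x I s).2).
Proof.
move=> [pre [post [eC sp]]] ok.
have EI : nth (ijump 0) code p = I by rewrite eC nth_cat sp ltnn subnn.
have pL : p <= size code by rewrite eC size_cat sp leq_addr.
by move: (@go_instr code x p s pL); rewrite EI => /(_ ok)[m _ g]; exists m.
Qed.

Lemma reach_refl (c : Config (mprog code)) : reach false c c.
Proof. by exists 0; apply: go0. Qed.

Lemma compile_correct x c s s' f p : exec x c s s' f -> cmd_ok c -> placed p (compile c p) ->
  reach f (cfg code x p s) (cfg code x (p + size (compile c p)) s').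
Proof.
move=> E; elim: E p => {c s s' f}
  [s|s|i s|i s|c1 c2 s1 s2 s3 f1 f2 _ IH1 _ IH2|i c1 c2 s s' f _ IH
  |o i c1 c2 s s' f _ IH|i c s si0|i c s1 s2 s3 f1 f2 si _ IH1 _ IH2] p /=.
- by rewrite addn0 => _ _; apply: reach_refl.
- by move=> _ pl; rewrite addn1; apply: (reach_instr x s pl).
- by move=> ok pl; rewrite addn1; apply: (reach_instr x s pl).
- by move=> ok pl; rewrite addn1; apply: (reach_instr x s pl).
- move=> /andP[ok1 ok2] /placed_cat[pl1 pl2].
  by rewrite size_cat addnA; apply: reach_trans (IH1 _ ok1 pl1) (IH2 _ ok2 pl2).
- move=> /and4P[i4 iK ok1 ok2].
  set l1 := compile c1 _; set q := p.+1 + size l1; set l2 := compile c2 _.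
  move=> /placed_cons[plI /placed_cat[pl1 /placed_cons[plJ pl2]]].
  have -> : p + (size (l1 ++ ijump (q.+1 + size l2) :: l2)).+1 = q.+1 + size l2.
    by rewrite size_cat /= /q; lia.
  apply: (reach_trans (reach_instr x s plI _)); first by rewrite /= i4.
  rewrite /=; case: eqP IH => _ IH.
    rewrite -[f]orbF; apply: reach_trans; first by apply: IH.
    by apply: (reach_trans (reach_instr x s' plJ _)) => //=; rewrite if_same; apply: reach_refl.
  exact: IH.
- move=> /and5P[o4 i4 iK ok1 ok2].
  set l1 := compile c1 _; set q := p.+1 + size l1; set l2 := compile c2 _.
  move=> /placed_cons[plI /placed_cat[pl1 /placed_cons[plJ pl2]]].
  have -> : p + (size (l1 ++ ijump (q.+1 + size l2) :: l2)).+1 = q.+1 + size l2.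
    by rewrite size_cat /= /q; lia.
  apply: (reach_trans (reach_instr x s plI _)); first by rewrite /= i4 o4.
  rewrite /=; case: (x _) IH => IH.
    rewrite -[f]orbF; apply: reach_trans; first by apply: IH.
    by apply: (reach_trans (reach_instr x s' plJ _)) => //=; rewrite if_same; apply: reach_refl.
  exact: IH.
- move=> /and3P[i4 iK ok]; rewrite -cats1 => /placed_cons[plI _].
  have -> : p + (size (compile c p.+1 ++ [:: ijump p])).+1 = (p.+1 + size (compile c p.+1)).+1.
    by rewrite size_cat /=; lia.
  move: (reach_instr x s plI); rewrite /= si0 /=; apply; by rewrite i4.
- move=> /and3P[i4 iK ok]; rewrite -cats1 => pl.
  move: (pl) => /placed_cons[plI /placed_cat[pl1 plJ]].
  apply: (reach_trans (reach_instr x s1 plI _)); first by rewrite /= i4.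
  rewrite /= (negPf si); apply: reach_trans; first exact: IH1.
  rewrite -[f2]/(false || f2).
  apply: (reach_trans (reach_instr x s2 plJ _)) => //=; rewrite if_same.
  by move: (IH2 p); rewrite /= -cats1 i4 iK ok; apply.
Qed.

End Compile.

(* Label [size (compile c 0)] lies outside the code, where the default
   instruction jumps back to 0. *)
Lemma go_cycle x c s s' f : exec x c s s' f -> cmd_ok c ->
  exists2 m, 0 < m & go m f (cfg (compile c 0) x 0 s) (cfg (compile c 0) x 0 s').
Proof.
move=> E ok; have [|m g] := @compile_correct (compile c 0) x c s s' f 0 E ok.
  by exists [::], [::]; rewrite cats0.
have := @go_instr (compile c 0) x (size (compile c 0)) s' (leqnn _).
rewrite nth_default // => /(_ isT)[m' m'0 g'].
exists (m + m'); first by lia.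
by rewrite -[f]orbF; apply: go_trans g _; move: g'; rewrite /= if_same.
Qed.

(** * Acceptance at time omega *)

Section Limits.
Variables (p : Prog) (x : real).

Definition limsup (u : nat -> bool) : bool := `[< forall j, exists2 j', j <= j' & u j' >].

Definition omega_limit (c : Config p) : Config p :=
  {| cst := limit_st p; chead := 0;
     tape1 := fun k => limsup (fun j => tape1 (iter j (@step p) c) k);
     tape2 := fun k => limsup (fun j => tape2 (iter j (@step p) c) k);
     tape3 := fun k => limsup (fun j => tape3 (iter j (@step p) c) k) |}.

Definition run2 (s : seq nat) : Config p :=
  iter (nth 0 s 1) (@step p) (iter (nth 0 s 0) omega_limit (init p x)).

Lemma lexle2 a b c d : lexle [:: a; b] [:: c; d] = (a < c) || (a == c) && (b <= d).
Proof. by rewrite /lexle /= !eqseq_cons; do 2 case: ltngtP => //=; lia. Qed.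

Lemma lexlt2 a b c d : lexlt [:: a; b] [:: c; d] = (a < c) || (a == c) && (b < d).
Proof. by rewrite /= andbF orbF. Qed.

(** The stages [[:: i; j]] form a final segment below [[:: i.+1; 0]], and the limsup depends on a
    final segment only. *)
Lemma limsup_beforeE (f : seq nat -> bool) i :
  limsup (fun j => f [:: i; j]) = true <-> limsup_before 2 f [:: i.+1; 0].
Proof.
split.
- move/asboolP => H [|b0 [|b1 [|? ?]]] // _; rewrite lexlt2 => bi.
  have [j' b1j fj] := H b1; exists [:: i; j'].
  by rewrite lexle2 lexlt2; split => //; lia.
- move=> H; apply/asboolP => j; have [||g [sg]] := H [:: i; j] => //; first by rewrite lexlt2; lia.
  case: g sg => [|g0 [|g1 [|? ?]]] // _; rewrite lexle2 lexlt2 => h1 h2 fg.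
  have e0 : g0 = i by lia.
  by exists g1; [lia|rewrite -e0].
Qed.

Lemma run2P : run p x 2 run2.
Proof.
split.
- by case=> [|a [|b [|? ?]]] //= _ /andP[/eqP -> /andP[/eqP -> _]].
- by case=> [|a [|b [|? ?]]].
- case=> [|a [|b [|? ?]]] //= _; rewrite /is_limit /= andbT => /andP[nz /eqP b0].
  move: nz; rewrite b0 eqxx andbT; case: a => // a _; split => // k.
  by split; [|split]; apply: (limsup_beforeE (fun s => _ (run2 s) k)).
Qed.

Lemma halts_after_omega :
  (forall j, cst (iter j (@step p) (init p x)) <> halt_st p) ->
  limit_st p <> halt_st p ->
  let c := step (omega_limit (init p x)) in cst c = halt_st p ->
  HaltsWith p 2 x (tape3 c 0).
Proof.
move=> nh lh c ch; exists run2; split; first exact: run2P.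
(* This is stage omega + 1; the earlier ones are the finite stages and omega itself. *)
exists [:: 1; 1]; split=> //.
case=> [|[|a] [|b [|? ?]]] // _; rewrite lexlt2; first by move=> _; apply: nh.
by move=> ab; have [-> ->] : a = 0 /\ b = 0 by lia.
Qed.

End Limits.

Lemma goP code m f (c c' : Config (mprog code)) : go m f c c' ->
  [/\ iter m (@step _) c = c',
      forall j, j < m -> cst (iter j (@step _) c) <> halt_st (mprog code) &
      f = true <-> exists2 j, j < m & tape3 (iter j (@step _) c) 0].
Proof.
elim=> {m f c c'} [c|m f c c' cH g [IH1 IH2 IH3]].
  by split => //; split=> // -[].
split; first by rewrite iterSr.
  case=> [_|j jm]; first exact/eqP.
  by rewrite iterSr; apply: IH2.
split.
  case/orP => [t|/IH3 [j jm tj]]; first by exists 0.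
  by exists j.+1 => //; rewrite iterSr.
case=> -[_ /= -> //|j jm]; rewrite iterSr => tj.
by apply/orP; right; apply/IH3; exists j.
Qed.

(** Every round takes a positive finite number of steps, so the rounds fill exactly the time up to
    omega, and output cell 0 is raised cofinally often iff infinitely many rounds flash. *)
Lemma forever_halts x c (st : nat -> memory) (fl : nat -> bool) : cmd_ok c ->
  st 0 = (fun=> 0) -> (forall m, exec x c (st m) (st m.+1) (fl m)) ->
  HaltsWith (mprog (compile c 0)) 2 x (limsup fl).
Proof.
move=> ok st0 E; set P := mprog _.
have [m0 m0_gt0 /goP[g1 g2 g3]] := go_init (compile c 0) x.
have H m : exists k, 0 < k /\ go k (fl m) (cfg (compile c 0) x 0 (st m)) (cfg (compile c 0) x 0 (st m.+1)).
  by have [k k0 g] := go_cycle (E m) ok; exists k.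
have [k Hk] := choice H.
(* [tau m] is the time at which round [m] starts, after [m0] steps of initialisation. *)
pose tau := fix tau m := if m is m'.+1 then tau m' + k m' else m0.
have tauE m : iter (tau m) (@step P) (init P x) = cfg (compile c 0) x 0 (st m).
  elim: m => [|m IH] /=; first by rewrite g1 st0.
  by have [_ /goP[h _ _]] := Hk m; rewrite addnC iterD IH h.
have tau_mono m m' : m <= m' -> tau m <= tau m'.
  elim: m' => [|m' IH]; first by rewrite leqn0 => /eqP ->.
  by rewrite leq_eqVlt => /orP[/eqP -> //|/IH /=]; lia.
have tau_ge m : m <= tau m.
  by elim: m => //= m IH; have [k0 _] := Hk m; lia.
have slot j : j < m0 \/ exists2 m, tau m <= j & j < tau m.+1.
  elim: j => [|j [IH|[m h1 h2]]]; first by left.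
    case: (ltnP j.+1 m0) => h; first by left.
    by right; exists 0 => //=; have [k0 _] := Hk 0; lia.
  right; case: (ltnP j.+1 (tau m.+1)) => h; first by exists m => //; lia.
  by exists m.+1 => //; have [k0 _] := Hk m.+1; move: h2 => /=; lia.
have split_time m j : tau m <= j ->
    iter j (@step P) (init P x) = iter (j - tau m) (@step P) (cfg (compile c 0) x 0 (st m)).
  by move=> h; rewrite -tauE -iterD subnK.
have nh j : cst (iter j (@step P) (init P x)) <> halt_st P.
  case: (slot j) => [/g2 //|[m h1 h2]].
  have [_ /goP[_ h _]] := Hk m; rewrite (split_time m) //; apply: h.
  by move: h2 => /=; lia.
have -> : limsup fl = tape3 (step (omega_limit (init P x))) 0.
  have -> : tape3 (step (omega_limit (init P x))) 0 =
            limsup (fun j => tape3 (iter j (@step P) (init P x)) 0) by [].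
  apply/idP/idP => /asboolP h; apply/asboolP => j.
    have [m jm fm] := h j; have [_ /goP[_ _ [/(_ fm) [i ik ti] _]]] := Hk m.
    exists (tau m + i); first by have := tau_ge m; lia.
    by rewrite (split_time m) ?leq_addr // addKn.
  have [i ti fi] := h (tau j); case: (slot i) => [im0|[m h1 h2]].
    by have := tau_mono 0 j isT; rewrite /=; lia.
  exists m; first by rewrite leqNgt; apply/negP => /tau_mono; lia.
  have [_ /goP[_ _ [_ a]]] := Hk m; apply: a; exists (i - tau m); first by move: h2 => /=; lia.
  by rewrite -split_time.
exact: halts_after_omega.
Qed.

(** * The verifier *)

(** Triangular numbers; [pr] is the Cantor pairing function. *)
Fixpoint tri n := if n is m.+1 then tri m + n else 0.
Definition pr N M := tri (N + M) + M.

(* Lexicographic comparison of two rows of bits, looking at [fuel] positions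
   from [t] on. The common prefix may contain at most as many zeros as it has
   leading ones: [h] is the remaining allowance, and [ph] records whether a
   zero has been met. *)
Fixpoint cmp (f g : real) fuel t h (ph : bool) : bool :=
  if fuel is n.+1 then
    match f t, g t with
    | true, true => cmp f g n t.+1 (if ph then h else h.+1) ph
    | true, false => false
    | false, true => true
    | false, false => if h is h'.+1 then cmp f g n t.+1 h' true else false
    end
  else false.

(** In an input [pairR x y] the even cells carry [x] and the odd ones [y]: offsets 0 and 2 read
    wires and rows of the circuit, offset 1 reads the guessed valuation. *)
Definition bitV (z : real) a := z (K * a + 1).
Definition bitE (z : real) a := z (K * a + 0).
Definition bitS (z : real) a := z (K * a + 2).

Definition row z N : real := fun t => bitS z (pr N t).
Definition below z M N := cmp (row z M) (row z N) M 0 0 false.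
Definition chk z N M := [&& bitV z M, bitE z (pr N M) & below z M N].

(** [vN], [vM], [vJ] hold the search state and [vQ] the gate tested against [vN]; [vA], [vB] are
    computed addresses, [vS], [vU], [vW] scratch, [vR] the result, and [vT], [vH], [vP], [vF] the
    arguments of [cmp]. [vZ] stays 0 and addresses the root. *)
Notation vN := 4. Notation vM := 5. Notation vJ := 6. Notation vQ := 7.
Notation vA := 8. Notation vB := 9. Notation vS := 10. Notation vU := 11.
Notation vW := 12. Notation vR := 13. Notation vT := 14. Notation vH := 15.
Notation vP := 16. Notation vF := 17. Notation vZ := 18.

Notation "c1 ;; c2" := (CSeq c1 c2) (at level 60, right associativity).

Definition clr a := CWhile a (CDec a).
Definition mv a b := CWhile a (CDec a ;; CInc b).
Definition mv2 a b c := CWhile a (CDec a ;; CInc b ;; CInc c).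
Definition add a b := mv2 a b vW ;; mv vW a.
Definition pairc a b d :=
  add a vS ;; add b vS ;; add b d ;;
  CWhile vS (CDec vS ;; CInc d ;; mv2 vS d vU ;; mv vU vS).

Definition cmp_body :=
  CDec vF ;; pairc vQ vT vA ;; pairc vN vT vB ;;
  CIfQ 2 vA
    (CIfQ 2 vB (CInc vT ;; CIfZ vP (CInc vH) CSkip) (clr vF))
    (CIfQ 2 vB (CInc vR ;; clr vF) (CIfZ vH (clr vF) (CDec vH ;; CInc vP ;; CInc vT))) ;;
  clr vA ;; clr vB.

Definition belowc := add vQ vF ;; CWhile vF cmp_body ;; clr vT ;; clr vH ;; clr vP.

Definition chkc := CIfQ 1 vQ (pairc vN vQ vA ;; CIfQ 0 vA (clr vA ;; belowc) (clr vA)) CSkip.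

Definition advc := CFlash ;; clr vJ ;; CInc vM ;; CIfZ vN (mv vM vN) (CDec vN).

(* [(N, M)] runs through all pairs, and [J] searches for a witness. With
   [V] the guessed valuation, if [V N] then [M] must not fire [N], else some [J]
   must fire [N]; in both cases the round succeeds when [V N] differs from the
   result of the check, and otherwise only [J] grows. *)
Definition roundc :=
  CIfQ 1 vN (add vM vQ) (add vJ vQ) ;; chkc ;; clr vQ ;;
  CIfQ 1 vN (CIfZ vR advc (CInc vJ)) (CIfZ vR (CInc vJ) advc) ;; clr vR.

(** If the guessed value of the root differs from [b], the program idles and never flashes. *)
Definition verifier (b : bool) :=
  if b then CIfQ 1 vZ roundc CSkip else CIfQ 1 vZ CSkip roundc.

Lemma verifier_ok b : cmd_ok (verifier b).
Proof. by case: b. Qed.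

(** * Execution of the verifier and its behaviour in the limit *)

Section Semantics.
Variable z : real.

Lemma XseqF c1 c2 s1 s2 s3 f :
  exec z c1 s1 s2 false -> exec z c2 s2 s3 f -> exec z (c1 ;; c2) s1 s3 f.
Proof. exact: XSeq. Qed.

Lemma XwhileSF i c s1 s2 s3 : s1 i != 0 ->
  exec z c s1 s2 false -> exec z (CWhile i c) s2 s3 false -> exec z (CWhile i c) s1 s3 false.
Proof. exact: (@XWhileS _ _ _ _ _ _ false false). Qed.

Lemma exec_eq c s s1 s2 f : exec z c s s1 f -> s1 = s2 -> exec z c s s2 f.
Proof. by move=> h <-. Qed.

Ltac ev := rewrite /set; repeat (case: eqP => ? //=); subst; try lia.
Ltac mem := apply: funext => ?; ev.

Lemma X_clr a s : exec z (clr a) s (set s a 0) false.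
Proof.
move E: (s a) => n; elim: n s E => [|n IH] s E.
  by apply: exec_eq (XWhile0 _ _ E) _; rewrite -{1}(set_id s a) E.
apply: XwhileSF; [by rewrite E|exact: XDec|].
apply: exec_eq; first by apply: IH; rewrite /set eqxx E.
by mem.
Qed.

Lemma X_mv a b s : a != b -> exec z (mv a b) s (set (set s b (s b + s a)) a 0) false.
Proof.
move=> ab; move E: (s a) => n; elim: n s E => [|n IH] s E.
  by apply: exec_eq (XWhile0 _ _ E) _; mem.
apply: XwhileSF; [by rewrite E|apply: XseqF; [exact: XDec|exact: XInc]|].
apply: exec_eq; first by apply: IH; rewrite /set eqxx (negPf ab) E.
by mem.
Qed.

Lemma X_mv2 a b c s : a != b -> a != c -> b != c ->
  exec z (mv2 a b c) s (set (set (set s b (s b + s a)) c (s c + s a)) a 0) false.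
Proof.
move=> ab ac bc; move E: (s a) => n; elim: n s E => [|n IH] s E.
  by apply: exec_eq (XWhile0 _ _ E) _; mem.
apply: XwhileSF; [by rewrite E|
  apply: XseqF; [exact: XDec|apply: XseqF; [exact: XInc|exact: XInc]]|].
apply: exec_eq; first by apply: IH; rewrite /set eqxx (negPf ab) (negPf ac) E.
by mem.
Qed.

Lemma X_add a b s : a != b -> a != vW -> b != vW -> s vW = 0 ->
  exec z (add a b) s (set s b (s b + s a)) false.
Proof.
move=> ab aw bw s0; apply: XseqF; first exact: X_mv2.
apply: exec_eq; first by apply: X_mv; rewrite eq_sym.
by mem.
Qed.

(** A pass with [vS] equal to [k.+1] adds 1 and then the remaining [k] to [d]; [vU] keeps the copy
    from which [vS] is restored. *)
Lemma X_tri d s : d \notin [:: vS; vU] -> s vU = 0 ->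
  exec z (CWhile vS (CDec vS ;; CInc d ;; mv2 vS d vU ;; mv vU vS)) s
    (set (set s d (s d + tri (s vS))) vS 0) false.
Proof.
rewrite !inE negb_or => /andP[d1 d2].
move E: (s vS) => n; elim: n s E => [|n IH] s E s0.
  by apply: exec_eq (XWhile0 _ _ E) _; mem.
apply: XwhileSF; first by rewrite E.
  apply: XseqF; first exact: XDec.
  apply: XseqF; first exact: XInc.
  apply: XseqF; first by apply: X_mv2 => //; rewrite eq_sym.
  exact: X_mv.
apply: exec_eq.
  by apply: IH; ev.
by mem.
Qed.

Lemma X_pair a b d s : a \notin [:: vS; vU; vW] -> b \notin [:: vS; vU; vW] ->
  d \notin [:: vS; vU; vW; a; b] -> s vS = 0 -> s vU = 0 -> s vW = 0 -> s d = 0 ->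
  exec z (pairc a b d) s (set s d (pr (s a) (s b))) false.
Proof.
rewrite !inE !negb_or => /and3P[a1 a2 a3] /and3P[b1 b2 b3] /and5P[d1 d2 d3 d4 d5] s1 s2 s3 s4.
apply: XseqF; first exact: X_add.
apply: XseqF; first by apply: X_add.
apply: XseqF; first by apply: X_add => //; rewrite eq_sym.
apply: exec_eq; first by apply: X_tri; rewrite ?inE ?negb_or ?d1 ?d2 //; ev.
by rewrite /pr; mem; rewrite s1 s4 !add0n addnC.
Qed.

Definition idle (s : memory) (vs : seq nat) := forall i, i \in vs -> s i = 0.

Lemma X_cmp_body s : 0 < s vF -> idle s [:: vA; vB; vS; vU; vW] ->
  let f := row z (s vQ) in let g := row z (s vN) in
  let t := s vT in let h := s vH in
  exec z cmp_body s
    (let s1 := set s vF (s vF).-1 in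
     match f t, g t with
     | true, true => let s2 := set s1 vT t.+1 in if s vP == 0 then set s2 vH h.+1 else s2
     | true, false => set s1 vF 0
     | false, true => set (set s1 vR (s vR).+1) vF 0
     | false, false => if h is h'.+1 then set (set (set s1 vH h') vP (s vP).+1) vT t.+1
                       else set s1 vF 0
     end) false.
Proof.
move=> F0 id0 f g t h.
have [iA iB iS iU iW] : [/\ s vA = 0, s vB = 0, s vS = 0, s vU = 0 & s vW = 0].
  by split; apply: id0.
apply: XseqF; first exact: XDec.
apply: XseqF; first exact: X_pair.
apply: XseqF; first exact: X_pair.
set s1 := set (set _ _ _) _ _.
set s2 := (X in exec _ _ _ X _).
have fA : z (K * s1 vA + 2) = f t by [].
have gB : z (K * s1 vB + 2) = g t by [].
suff [s3 E e3] : exists2 s3, exec z (CIfQ 2 vA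
    (CIfQ 2 vB (CInc vT ;; CIfZ vP (CInc vH) CSkip) (clr vF))
    (CIfQ 2 vB (CInc vR ;; clr vF) (CIfZ vH (clr vF) (CDec vH ;; CInc vP ;; CInc vT))))
   s1 s3 false & set (set s3 vA 0) vB 0 = s2.
  apply: XseqF; first exact: E.
  apply: XseqF; first exact: X_clr.
  by apply: exec_eq; first exact: X_clr.
rewrite /s2; case: (f t) fA => fA; case: (g t) gB => gB.
- case: eqP => P0.
    exists (set (set s1 vT t.+1) vH h.+1); last by rewrite /s1; mem.
    apply: XIfQ; rewrite fA; apply: XIfQ; rewrite gB; apply: XseqF; first exact: XInc.
    by apply: XIfZ; rewrite ifT; [exact: XInc|rewrite /s1 /set /= P0].
  exists (set s1 vT t.+1); last by rewrite /s1; mem.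
  apply: XIfQ; rewrite fA; apply: XIfQ; rewrite gB; apply: XseqF; first exact: XInc.
  by apply: XIfZ; rewrite ifN; [exact: XSkip|exact/eqP].
- exists (set s1 vF 0); last by rewrite /s1; mem.
  by apply: XIfQ; rewrite fA; apply: XIfQ; rewrite gB; apply: X_clr.
- exists (set (set s1 vR (s vR).+1) vF 0); last by rewrite /s1; mem.
  apply: XIfQ; rewrite fA; apply: XIfQ; rewrite gB; apply: XseqF; first exact: XInc.
  exact: X_clr.
- case E : h => [|h'].
    exists (set s1 vF 0); last by rewrite /s1; mem.
    apply: XIfQ; rewrite fA; apply: XIfQ; rewrite gB; apply: XIfZ.
    by rewrite ifT; [exact: X_clr|apply/eqP].
  exists (set (set (set s1 vH h') vP (s vP).+1) vT t.+1); last by rewrite /s1; mem.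
  apply: XIfQ; rewrite fA; apply: XIfQ; rewrite gB; apply: XIfZ.
  rewrite ifN; last by rewrite [s1 vH]E.
  apply: XseqF; first exact: XDec.
  rewrite (_ : (s1 vH).-1 = h'); last by rewrite [s1 vH]E.
  by apply: XseqF; exact: XInc.
Qed.

(** Each pass of the loop is one unfolding of [cmp]: it clears [vF] and thereby ends the loop
    ([stop]), or it matches a recursive call ([more]). *)
Lemma X_cmp n s : s vF = n -> idle s [:: vA; vB; vS; vU; vW; vR] ->
  exists s', [/\ exec z (CWhile vF cmp_body) s s' false,
    s' vR = cmp (row z (s vQ)) (row z (s vN)) n (s vT) (s vH) (s vP != 0),
    s' vF = 0 & forall i, i \notin [:: vT; vH; vP; vR; vF] -> s' i = s i].
Proof.
elim: n s => [|n IH] s sF id0.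
  by exists s; split=> //; [exact: XWhile0|rewrite id0].
have F0 : 0 < s vF by rewrite sF.
have id1 : idle s [:: vA; vB; vS; vU; vW].
  by move=> i ii; apply: id0; move: ii; rewrite !inE => /or4P[->|->|->|/orP[->|->]]; rewrite ?orbT.
have R0 : s vR = 0 by apply: id0.
have B := X_cmp_body F0 id1; cbv zeta in B.
set s1 := (X in exec _ _ _ X _) in B.
have sN0 : s vF != 0 by rewrite sF.
have stop : s1 vF = 0 ->  (forall i, i \notin [:: vT; vH; vP; vR; vF] -> s1 i = s i) ->
   s1 vR = cmp (row z (s vQ)) (row z (s vN)) n.+1 (s vT) (s vH) (s vP != 0) ->
   exists s', [/\ exec z (CWhile vF cmp_body) s s' false,
    s' vR = cmp (row z (s vQ)) (row z (s vN)) n.+1 (s vT) (s vH) (s vP != 0),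
    s' vF = 0 & forall i, i \notin [:: vT; vH; vP; vR; vF] -> s' i = s i].
  by move=> h1 h2 h3; exists s1; split=> //; apply: XwhileSF sN0 B _; apply: XWhile0.
have more : s1 vF = n -> (forall i, i \notin [:: vT; vH; vP; vR; vF] -> s1 i = s i) ->
   s1 vR = 0 ->
   cmp (row z (s vQ)) (row z (s vN)) n.+1 (s vT) (s vH) (s vP != 0) =
   cmp (row z (s vQ)) (row z (s vN)) n (s1 vT) (s1 vH) (s1 vP != 0) ->
   exists s', [/\ exec z (CWhile vF cmp_body) s s' false,
    s' vR = cmp (row z (s vQ)) (row z (s vN)) n.+1 (s vT) (s vH) (s vP != 0),
    s' vF = 0 & forall i, i \notin [:: vT; vH; vP; vR; vF] -> s' i = s i].
  move=> h1 h2 h3 h4; have [|s' [e1 e2 e3 e4]] := IH s1 h1.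
    move=> i; rewrite !inE => /or4P[/eqP->|/eqP->|/eqP->|/or3P[/eqP->|/eqP->|/eqP->]] //;
    rewrite h2 //; exact: id0.
  exists s'; split => //; first exact: XwhileSF sN0 B e1.
    by rewrite e2 h4 (h2 vQ isT) (h2 vN isT).
  by move=> i ii; rewrite e4 // h2.
have out s2 : (forall i, i \notin [:: vT; vH; vP; vR; vF] -> s2 i = s i) ->
  forall j v, j \in [:: vT; vH; vP; vR; vF] ->
  forall i, i \notin [:: vT; vH; vP; vR; vF] -> set s2 j v i = s i.
  by move=> h j v jj i ii; rewrite /set; case: eqP => [e|_]; [rewrite e jj in ii|apply: h].
move: stop more; rewrite /s1 /=; case: (row z (s vQ) _); case: (row z (s vN) _) => stop more.
- case: eqP more => [P0|/eqP P0] more.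
    by apply: more; [rewrite /set /= sF|do ![apply: (out _) => //]|rewrite /set /= R0|
      rewrite /set /= P0].
  by apply: more; [rewrite /set /= sF|do ![apply: (out _) => //]|rewrite /set /= R0|
    rewrite /set /= P0].
- by apply: stop => //; do ![apply: (out _) => //].
- by apply: stop; [|do ![apply: (out _) => //]|rewrite /set /= R0].
- case: (s vH) stop more => [|h'] stop more.
    by apply: stop => //; do ![apply: (out _) => //].
  by apply: more; [rewrite /set /= sF|do ![apply: (out _) => //]|rewrite /set /= R0|].
Qed.

Lemma X_below s : idle s [:: vA; vB; vS; vU; vW; vR; vT; vH; vP; vF] ->
  exec z belowc s (set s vR (below z (s vQ) (s vN))) false.
Proof.
move=> id0; apply: XseqF; first by apply: X_add => //; apply: id0.
set s1 := set _ _ _.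
have [||s2 [e1 e2 e3 e4]] := @X_cmp (s vQ) s1 _ _.
- by rewrite /s1 /set /= id0.
- move=> i; rewrite !inE => /or4P[/eqP->|/eqP->|/eqP->|/or3P[/eqP->|/eqP->|/eqP->]];
  by rewrite /s1 /set /= id0.
apply: XseqF; first exact: e1.
apply: XseqF; first exact: X_clr.
apply: XseqF; first exact: X_clr.
apply: exec_eq; first exact: X_clr.
have s1E i : s1 i = if i == vF then s vQ else s i.
  by rewrite /s1 /set; case: eqP => // _; rewrite id0.
apply: funext => i; rewrite /set.
case: (eqVneq i vP) => [->|iP]; first by rewrite /= id0.
case: (eqVneq i vH) => [->|iH]; first by rewrite /= id0.
case: (eqVneq i vT) => [->|iT]; first by rewrite /= id0.
case: (eqVneq i vR) => [->|iR]; first by rewrite e2 !s1E /= (id0 vT isT) (id0 vH isT) (id0 vP isT).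
case: (eqVneq i vF) => [->|iF]; first by rewrite e3 id0.
by rewrite e4 ?s1E ?(negPf iF) // !inE !negb_or iT iH iP iR iF.
Qed.

Lemma X_chk s : idle s [:: vA; vB; vS; vU; vW; vR; vT; vH; vP; vF] ->
  exec z chkc s (set s vR (chk z (s vN) (s vQ))) false.
Proof.
move=> id0; apply: XIfQ.
have noR : set s vR 0 = s by rewrite -[RHS](set_id s vR) id0.
rewrite -/(bitV z (s vQ)) /chk; case: (bitV z _); last by rewrite /= noR; apply: XSkip.
apply: XseqF; first by apply: X_pair => //; apply: id0.
have sA : set (set s vA (pr (s vN) (s vQ))) vA 0 = s by move: (id0 vA isT) => iA; mem.
apply: XIfQ; rewrite /= {1}/set /= -/(bitE z _).
case: (bitE z _) => /=; last by apply: exec_eq; [exact: X_clr|rewrite sA noR].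
apply: XseqF; first exact: X_clr.
by rewrite sA; apply: X_below.
Qed.

Definition mem3 N M J : memory :=
  fun i => if i == vN then N else if i == vM then M else if i == vJ then J else 0.

(** Walks along the antidiagonals of constant [N + M], so that every pair is met. *)
Definition nextp (NM : nat * nat) := if NM.1 is N.+1 then (N, NM.2.+1) else (NM.2.+1, 0).

Definition advances N M J := bitV z N != chk z N (if bitV z N then M else J).

Lemma X_adv s N M J R : s = set (mem3 N M J) vR R ->
  exec z advc s (set (mem3 (nextp (N, M)).1 (nextp (N, M)).2 0) vR R) true.
Proof.
move=> ->; apply: (@XSeq _ _ _ _ _ _ true false); first exact: XFlash.
apply: XseqF; first exact: X_clr.
apply: XseqF; first exact: XInc.
apply: XIfZ; case: N => [|N].
  by apply: exec_eq; [exact: X_mv|rewrite /mem3; mem].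
by apply: exec_eq; [exact: XDec|rewrite /mem3; mem].
Qed.

Lemma X_round N M J :
  let a := advances N M J in
  exec z roundc (mem3 N M J)
    (if a then mem3 (nextp (N, M)).1 (nextp (N, M)).2 0 else mem3 N M J.+1) a.
Proof.
move=> a; set Q := if bitV z N then M else J.
apply: XseqF.
  apply: (@exec_eq _ _ (set (mem3 N M J) vQ Q)); last by [].
  apply: XIfQ; rewrite -/(bitV z N) /Q; case: (bitV z N); exact: X_add.
apply: XseqF.
  by apply: X_chk; move=> i; rewrite !inE; do ![case/orP]; move/eqP=> ->.
rewrite [X in set _ vR X](_ : _ = nat_of_bool (chk z N Q)) //.
apply: XseqF; first exact: X_clr.
rewrite (_ : set (set (set _ _ _) _ _) _ _ = set (mem3 N M J) vR (chk z N Q)); last by rewrite /mem3; mem.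
pose s1 := if a then mem3 (nextp (N, M)).1 (nextp (N, M)).2 0 else mem3 N M J.+1.
rewrite -[a]orbF; apply: (@XSeq _ _ _ _ (set s1 vR (chk z N Q))); last first.
  by apply: exec_eq; [exact: X_clr|rewrite -/s1 /s1; case: (a); rewrite /mem3; mem].
apply: XIfQ; rewrite -/(bitV z N) /s1 /a /advances -/Q.
case: (bitV z N); apply: XIfZ; rewrite {1}/set /=; case: (chk z N Q) => /=.
- by apply: exec_eq; [exact: XInc|rewrite /mem3; mem].
- exact: X_adv.
- exact: X_adv.
- by apply: exec_eq; [exact: XInc|rewrite /mem3; mem].
Qed.

Definition state := (nat * nat * nat)%type.
Definition memof (c : state) := mem3 c.1.1 c.1.2 c.2.
Definition flag b (c : state) := (bitV z 0 == b) && advances c.1.1 c.1.2 c.2.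
Definition nexts b (c : state) : state :=
  if bitV z 0 == b then
    if advances c.1.1 c.1.2 c.2 then (nextp c.1, 0) else (c.1, c.2.+1)
  else c.

Lemma X_verifier b c : exec z (verifier b) (memof c) (memof (nexts b c)) (flag b c).
Proof.
case: c => [[N M] J]; rewrite /verifier /nexts /flag /memof.
have R := X_round N M J; cbv zeta in R.
case: b; apply: XIfQ; rewrite -/(bitV z 0); case: (bitV z 0) => //=; try exact: XSkip.
  by apply: exec_eq; [exact: R|rewrite /=; case: ifP].
by apply: exec_eq; [exact: R|rewrite /=; case: ifP].
Qed.

Definition consistent := forall N, bitV z N = true <-> forall M, ~~ chk z N M.

Definition trace b m : state := iter m (nexts b) (0, 0, 0).

Lemma nextp_onto NM : exists s, iter s nextp (0, 0) = NM.
Proof.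
case: NM => N M; move E: (N + M) => d; elim: d M N E => [|d IHd].
  by move=> M N; exists 0; have [-> ->] : N = 0 /\ M = 0 by lia.
elim=> [|M IHM] N E.
  have [s e] := IHd d 0 erefl; exists s.+1; rewrite iterS e /nextp /=; congr pair; lia.
have [|s e] := IHM N.+1; first by lia.
by exists s.+1; rewrite iterS e.
Qed.

(** When the root bit is [b], infinitely many flashes mean that no pair [(N, M)] blocks the search;
    a pair blocks it, for all values of [J], exactly when it refutes consistency. *)
Lemma limsup_flagP b :
  limsup (fun m => flag b (trace b m)) = true <-> bitV z 0 = b /\ consistent.
Proof.
split.
- move/asboolP => inf.
  have b0 : bitV z 0 == b by have [m _ /andP[]] := inf 0.
  split; first exact/eqP.
  (* From each stage of the enumeration a flash follows later, and until the first one only [J]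
     grows. *)
  have stages s : exists m J, trace b m = (iter s nextp (0, 0), J).
    elim: s => [|s [m [J e]]]; first by exists 0, 0.
    have [m' mm' fm'] := inf m.
    have [i [Hi fi]] : exists i, (forall j, j < i -> ~~ flag b (trace b (m + j))) /\
        flag b (trace b (m + i)).
      have ex : exists i, flag b (trace b (m + i)) by exists (m' - m); rewrite subnKC.
      exists (ex_minn ex); case: ex_minnP => i fi mi; split => // j ji.
      by apply/negP => /mi; lia.
    have tr j : j <= i -> trace b (m + j) = (iter s nextp (0, 0), J + j).
      elim: j => [_|j IH ji]; first by rewrite !addn0.
      have := Hi j ji; rewrite addnS /trace iterS -/(trace b _) IH ?(ltnW ji) //.
      by rewrite /flag /nexts b0 /= => /negPf ->; rewrite addnS.
    exists (m + i).+1, 0; rewrite /trace iterS -/(trace b _); move: fi; rewrite tr //.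
    by rewrite /flag /nexts b0 /= => ->.
  have adv N M : exists J, advances N M J.
    have [s es] := nextp_onto (N, M); have [m [J e]] := stages s; have [m' [J' e']] := stages s.+1.
    apply: contrapT => no.
    have stuck j : exists J, trace b (m + j) = (N, M, J).
      elim: j => [|j [J1 e1]]; first by exists J; rewrite addn0 e es.
      rewrite addnS /trace iterS -/(trace b _) e1 /nexts b0 /=; case: ifP => a; last by eexists.
      by case: no; exists J1.
    have [k mk /andP[_]] := inf m; have [J1] := stuck (k - m); rewrite subnKC // => -> /= a.
    by case: no; exists J1.
  move=> N; split.
    move=> vN M; have [J] := adv N M; by rewrite /advances vN; case: (chk z N M).
  move=> no; apply: contrapT => /negP/negPf vN; have [J] := adv N 0.
  by rewrite /advances vN (negPf (no J)).
- case=> /eqP b0 cons; apply/asboolP => m.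
  (* All values below the current [J] have already failed for the current pair. *)
  have inv k J' : J' < (trace b k).2 -> ~~ advances (trace b k).1.1 (trace b k).1.2 J'.
    elim: k J' => [//|k IH] J'; rewrite /trace iterS -/(trace b k) /nexts b0.
    case: ifP => //= a; rewrite ltnS leq_eqVlt => /orP[/eqP ->|/IH //]; by rewrite a.
  apply: contrapT => no.
  have tr j : trace b (m + j) = ((trace b m).1, (trace b m).2 + j).
    elim: j => [|j IH]; first by rewrite !addn0 -surjective_pairing.
    rewrite addnS /trace iterS -/(trace b (m + j)) {1}/nexts b0; case: ifP => a.
      by case: no; exists (m + j); rewrite ?leq_addr // /flag b0.
    by rewrite IH addnS.
  case E: (trace b m) tr (inv m) => [[N M] J] tr {}inv.
  have nadv J' : ~~ advances N M J'.
    case: (ltnP J' J) => [/inv //|JJ']; apply/negP => a.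
    by case: no; exists (m + (J' - J)); rewrite ?leq_addr // /flag b0 tr /= subnKC.
  case vN : (bitV z N).
    have := nadv 0; rewrite /advances vN; have /cons/(_ M)/negPf -> := vN.
    by [].
  have : ~ (forall M, ~~ chk z N M) by move/cons; rewrite vN.
  apply => J'; have := nadv J'; rewrite /advances vN.
  by case: (chk z N J').
Qed.

End Semantics.

(** * Runs and halting *)

Lemma lex_ind n (P : seq nat -> Prop) :
  (forall a, size a = n -> (forall b, size b = n -> lexlt b a -> P b) -> P a) ->
  forall a, size a = n -> P a.
Proof.
elim: n P => [|n IHn] P H.
  by move=> a /[dup] sa /size0nil a0; apply: H => // b /size0nil ->; rewrite a0.
case=> // x s [ss]; elim/ltn_ind: x s ss => x IHx.
apply: IHn => s ss IHs; apply: H => [|[|y t] //= [st] /orP[xy|/andP[/eqP -> ts]]].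
- by rewrite /= ss.
- exact: IHx.
- exact: IHs.
Qed.

Lemma lexlt_total a b : size a = size b -> [|| lexlt a b, a == b | lexlt b a].
Proof.
elim: a b => [|x a IH] [|y b] //= [/IH h]; rewrite eqseq_cons.
by case: ltngtP; rewrite ?orbT.
Qed.

Lemma incr_last_rcons s c : incr_last (rcons s c) = rcons s c.+1.
Proof. by elim: s => [|x [|y s] IH] //; congr cons; apply: IH. Qed.

Lemma lexlt_incr_last s : s != [::] -> lexlt s (incr_last s).
Proof.
case/lastP: s => // s c _; rewrite incr_last_rcons.
by elim: s => [|x s IH] /=; rewrite ?ltnSn // eqxx IH orbT.
Qed.

Lemma stageP a : ~~ is_zero a -> ~~ is_limit a ->
  exists b, [/\ size b = size a, a = incr_last b, 0 < size a & lexlt b a].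
Proof.
move=> nz; rewrite /is_limit nz /=; case/lastP: a nz => // s [|c] nz; rewrite last_rcons // => _.
exists (rcons s c); rewrite !size_rcons incr_last_rcons; split=> //.
rewrite -incr_last_rcons; apply: lexlt_incr_last; by case: (s).
Qed.

Lemma run_unique p x n r r' : run p x n r -> run p x n r' ->
  forall a, size a = n -> r a = r' a.
Proof.
move=> [z1 s1 l1] [z2 s2 l2]; apply: lex_ind => a sa IH.
case: (boolP (is_zero a)) => [za|nz]; first by rewrite z1 // z2.
case: (boolP (is_limit a)) => [la|nl]; last first.
  have [b [sb aE a0 ba]] := stageP nz nl; rewrite sa in sb a0.
  by rewrite aE s1 // s2 // IH.
have [q1 h1 t1] := l1 _ sa la; have [q2 h2 t2] := l2 _ sa la.
have ext (u v : real) (f g : nat -> seq nat -> bool) :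
    (forall k, u k = true <-> limsup_before n (f k) a) ->
    (forall k, v k = true <-> limsup_before n (g k) a) ->
    (forall k b, size b = n -> lexlt b a -> f k b = g k b) -> u = v.
  move=> hu hv fg; apply: funext => k; apply/idP/idP => [/hu|/hv] H; [apply/hv|apply/hu];
  move=> b sb ba; have [c [sc bc ca fc]] := H b sb ba; exists c; split=> //; by rewrite -fc fg.
move: q1 h1 t1 q2 h2 t2; case Ea: (r a) => [q h u1 u2 u3]; case Ea': (r' a) => [q' h' v1 v2 v3] /=.
move=> -> -> t1 -> -> t2; congr Build_Config.
- apply: (ext _ _ (fun k g => tape1 (r g) k) (fun k g => tape1 (r' g) k)) => [k|k|k b sb ba].
  + by have [] := t1 k. + by have [] := t2 k. + by rewrite IH.
- apply: (ext _ _ (fun k g => tape2 (r g) k) (fun k g => tape2 (r' g) k)) => [k|k|k b sb ba].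
  + by have [_ []] := t1 k. + by have [_ []] := t2 k. + by rewrite IH.
- apply: (ext _ _ (fun k g => tape3 (r g) k) (fun k g => tape3 (r' g) k)) => [k|k|k b sb ba].
  + by have [_ []] := t1 k. + by have [_ []] := t2 k. + by rewrite IH.
Qed.

Lemma HaltsWith_unique p n x b b' : HaltsWith p n x b -> HaltsWith p n x b' -> b = b'.
Proof.
move=> [r [R [a [sa ha fa <-]]]] [r' [R' [a' [sa' ha' fa' <-]]]].
have U := run_unique R R'; rewrite U // in ha *.
have /or3P[h|/eqP -> //|h] : [|| lexlt a a', a == a' | lexlt a' a].
  by apply: lexlt_total; rewrite sa sa'.
- by case: (fa' a).
- by case: (fa a' sa' h); rewrite U.
Qed.

(** * Well-founded circuits *)

Definition lead (f : real) n := (forall s, s < n -> f s) /\ f n = false.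
Definition shift n (f : real) : real := fun t => f (n + t).

(* [lexS P] compares the leading blocks of ones and, if these are equal and
   finite, the rows behind the first zero with [P]. *)
Definition lex0 (f g : real) := exists2 t, lead f t & forall s, s <= t -> g s.
Definition lexS (P : nat -> real -> real -> Prop) (f g : real) :=
  lex0 f g \/ exists n, [/\ lead f n, lead g n & P n (shift n.+1 f) (shift n.+1 g)].

Lemma lead_inj f n m : lead f n -> lead f m -> n = m.
Proof.
move=> [h1 e1] [h2 e2]; case: (ltngtP n m) => // [/h2|/h1]; first by rewrite e1.
by rewrite e2.
Qed.

Lemma lex0_lead g f m n : lead g m -> lead f n -> lex0 g f <-> m < n.
Proof.
move=> lg lf; split.
  move=> [t /(lead_inj lg) <- ft]; rewrite ltnNge; apply/negP => /ft.
  by case: lf => _ ->.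
move=> mn; exists m => // s sm; apply: lf.1; exact: leq_ltn_trans mn.
Qed.

(** A row below one with [n] leading ones has fewer of them, or equally many and a tail lower in
    [P n]: induction on [n], then along [P n]. A row of ones only is accessible since every row
    below it contains a zero. *)
Lemma lexS_wf P : (forall n, well_founded (P n)) -> well_founded (lexS P).
Proof.
move=> wP.
have fin n f : lead f n -> Acc (lexS P) f.
  elim/ltn_ind: n f => n IH f lf; move Eu: (shift n.+1 f) => u.
  elim: (wP n u) f lf Eu => {}u _ IHu f lf Eu; constructor=> g.
  case=> [h|[m [lg lf' h]]].
    by have [t lg _] := h; apply: (IH t) => //; apply/(lex0_lead lg lf).
  have e := lead_inj lf lf'; subst m.
  by apply: (IHu (shift n.+1 g)) => //; rewrite -Eu.
move=> f; case: (pselect (exists n, lead f n)) => [[n] /fin //|no].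
constructor=> g [[t /fin //]|[m [/fin //]]].
Qed.

Fixpoint lexn n : real -> real -> Prop :=
  if n is m.+1 then lexS (fun=> lexn m) else fun _ _ => False.

Lemma lexn_wf n : well_founded (lexn n).
Proof. by elim: n => [|n IH] /=; [move=> f; constructor|apply: lexS_wf]. Qed.

(** [u] is the start of the current block of ones. Each common zero spends one unit of the allowance
    and opens a new block, so at most [h.+1] blocks are compared. *)
Lemma cmp_lexn (f g : real) fuel : forall u t h, (forall s, u <= s < t -> f s /\ g s) -> u <= t ->
  cmp f g fuel t h true -> lexn h.+1 (shift u f) (shift u g).
Proof.
elim: fuel => [//|n IH] u t h ones ut /=.
case ft : (f t); case gt : (g t) => //.
- apply: IH; last exact: leqW.
  move=> s /andP[us]; rewrite ltnS leq_eqVlt => /orP[/eqP ->|st]; first by rewrite ft gt.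
  by apply: ones; rewrite us.
- move=> _; left; exists (t - u).
    by split=> [s st|]; [apply: (ones _ _).1; lia|rewrite /shift subnKC].
  move=> s; rewrite leq_eqVlt => /orP[/eqP ->|st]; first by rewrite /shift subnKC.
  by apply: (ones _ _).2; lia.
- have lf : lead (shift u f) (t - u).
    by split=> [s st|]; [apply: (ones _ _).1; lia|rewrite /shift subnKC].
  have lg : lead (shift u g) (t - u).
    by split=> [s st|]; [apply: (ones _ _).2; lia|rewrite /shift subnKC].
  case: h => // h H; right; exists (t - u); split => //.
  have sh (k : real) : shift (t - u).+1 (shift u k) = shift t.+1 k.
    by apply: funext => i; rewrite /shift; congr k; lia.
  by rewrite !sh; apply: IH H => // s; lia.
Qed.

(** Before the first zero the allowance equals the number [t] of ones read, so the length of the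
    first block bounds the number of blocks compared after it. *)
Lemma cmp_lexS (f g : real) fuel : forall t, (forall s, s < t -> f s /\ g s) ->
  cmp f g fuel t t false -> lexS lexn f g.
Proof.
elim: fuel => [//|n IH] t ones /=.
case ft : (f t); case gt : (g t) => //.
- by apply: IH => s; rewrite ltnS leq_eqVlt => /orP[/eqP ->|/ones]; rewrite ?ft ?gt.
- move=> _; left; exists t; first by split=> // s /ones[].
  by move=> s; rewrite leq_eqVlt => /orP[/eqP ->|/ones []].
- move=> H; right; exists t; split; try by split=> // s /ones[].
  (* The first zero itself costs one unit: [t.+1] ones leave [t], which yields [lexn t.+1]. *)
  by case: t ones {ft gt} H => // t ones H; apply: cmp_lexn H => // s; lia.
Qed.

(** * Circuits and their unique valuation *)

Section Circuit.
Variable e : real.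

(** The factor 10 is half of [K]: a block of [K] cells of [pairR x y] holds 10 bits of [x]. *)
Definition edgebit N M := e (10 * pr N M).
Definition label N : real := fun t => e (10 * pr N t + 1).
Definition prec M N := cmp (label M) (label N) M 0 0 false.

(** A positive answer of the truncated comparison already places the labels in [lexS lexn], so
    [prec] inherits well-foundedness along [label], whatever [e] is. *)
Lemma prec_wf : well_founded prec.
Proof.
move=> N; move Ef: (label N) => f.
elim: (lexS_wf lexn_wf f) N Ef => {}f _ IH N Ef; constructor=> M.
by move/(@cmp_lexS _ _ _ 0 (fun s => fun h => match notF h with end)); rewrite Ef => /IH; apply.
Qed.

Definition fires (v : nat -> bool) N M := [&& v M, edgebit N M & prec M N].
Definition solution (v : nat -> bool) :=
  forall N, v N = true <-> forall M, ~~ fires v N M.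

Lemma solution_exists : exists v, solution v.
Proof.
pose F N (rec : forall M, prec M N -> bool) :=
  `[< forall M (h : prec M N), edgebit N M -> ~~ rec M h >].
pose v := Fix prec_wf (fun=> bool) F.
have vE N : v N = F N (fun M _ => v M).
  apply: Fix_eq => M f g fg; rewrite /F; congr asbool; apply: propext.
  by split=> H K h; [rewrite -fg|rewrite fg]; apply: H.
exists v => N; rewrite vE /F; split.
  move/asboolP => H M; apply/negP => /and3P[vM eM h].
  by have := H M h eM; rewrite vM.
move=> H; apply/asboolP => M h eM; apply/negP => vM.
by have := H M; rewrite /fires vM eM h.
Qed.

Lemma solution_unique v w : solution v -> solution w -> v =1 w.
Proof.
move=> sv sw; elim/(well_founded_ind prec_wf) => N IH.
have fE M : fires v N M = fires w N M.
  by rewrite /fires; case h : (prec M N); rewrite ?andbF // IH.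
apply/idP/idP => [/sv H|/sw H]; [apply/sw|apply/sv] => M; [rewrite -fE|rewrite fE]; exact: H.
Qed.

End Circuit.

(** * The separating set is in NP and in co-NP *)

Definition output b e := exists2 v, solution e v & v 0 = b.

Lemma bitE_pair x y a : bitE (pairR x y) a = x (10 * a).
Proof. by rewrite /bitE /pairR ifN; [congr x|]; lia. Qed.
Lemma bitS_pair x y a : bitS (pairR x y) a = x (10 * a + 1).
Proof. by rewrite /bitS /pairR ifN; [congr x|]; lia. Qed.
Lemma bitV_pair x y a : bitV (pairR x y) a = y (10 * a).
Proof. by rewrite /bitV /pairR ifT; [congr y|]; lia. Qed.

Lemma consistent_pair x y :
  consistent (pairR x y) <-> solution x (fun a => y (10 * a)).
Proof.
have fE N M : chk (pairR x y) N M = fires x (fun a => y (10 * a)) N M.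
  rewrite /chk /fires bitV_pair bitE_pair /below /prec; congr [&& _, _ & cmp _ _ _ _ _ _];
  by apply: funext => t; rewrite /row bitS_pair.
by split=> H N; have := H N; rewrite bitV_pair => -[h1 h2]; split;
  [move=> v M; move: (h1 v M); rewrite fE|move=> h; apply: h2 => M; move: (h M); rewrite fE
  |move=> v M; move: (h1 v M); rewrite fE|move=> h; apply: h2 => M; move: (h M); rewrite fE].
Qed.

Lemma output_NP b : inNP (output b).
Proof.
exists (mprog (compile (verifier b) 0)), 2.
have H x y : HaltsWith (mprog (compile (verifier b) 0)) 2 (pairR x y)
    (limsup (fun m => flag (pairR x y) b (trace (pairR x y) b m))).
  apply: (@forever_halts _ _ (fun m => memof (trace (pairR x y) b m))).
  - exact: verifier_ok.
  - by apply: funext => i; rewrite /memof /mem3 /=; do ![case: ifP => //].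
  - by move=> m; rewrite /trace iterS; apply: X_verifier.
split=> [x y|x]; first by eexists; apply: H.
split.
  (* The verifier reads [y] at multiples of 10, where this stretched copy of [v] has the values of
     [v]. *)
  case=> v sv v0; exists (fun k => v (k %/ 10)).
  have := H x (fun k => v (k %/ 10)).
  have -> // : limsup (fun m => flag (pairR x (fun k => v (k %/ 10))) b
      (trace (pairR x (fun k => v (k %/ 10))) b m)) = true.
  apply/limsup_flagP; rewrite bitV_pair consistent_pair; split; first by rewrite muln0 div0n.
  by rewrite (_ : (fun a => _) = v) //; apply: funext => a; rewrite mulKn.
case=> y /(HaltsWith_unique (H x y)) /limsup_flagP; rewrite bitV_pair consistent_pair => -[v0 sv].
by exists (fun a => y (10 * a)).
Qed.

(** Existence and uniqueness of the solution make [output true] and [output false] complementary. *)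
Lemma output_coNP : incoNP (output true).
Proof.
exists (output false); split; first exact: output_NP.
move=> e; split.
  move=> [v sv v0] [w sw w0]; by move: w0; rewrite -(solution_unique sv sw) v0.
move=> no; have [v sv] := solution_exists e; exists v => //.
by apply/negP => /negP/negPf v0; apply: no; exists v.
Qed.

(** * The circuit of a run on its own code *)

Lemma tri_ge n : n <= tri n.
Proof. by elim: n => //= n IH; lia. Qed.

Lemma tri_lt n m : n < m -> tri n + n < tri m.
Proof.
elim: m => // m IH; rewrite ltnS leq_eqVlt => /orP[/eqP ->|/IH] /=; lia.
Qed.

Lemma pr_inj N M N' M' : pr N M = pr N' M' -> N = N' /\ M = M'.
Proof.
rewrite /pr => E; case: (ltngtP (N + M) (N' + M')) => h.
- by have := tri_lt h; lia.
- by have := tri_lt h; lia.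
- by rewrite h in E; lia.
Qed.

Lemma pr_gel N M : N <= pr N M.
Proof. by rewrite /pr; have := tri_ge (N + M); lia. Qed.

Lemma pr_ger N M : M <= pr N M.
Proof. by rewrite /pr; lia. Qed.

(** Iterating [F] fixes bit [k] after [k.+1] rounds, since it depends on earlier bits only. *)
Lemma local_fixpoint (F : real -> real) :
  (forall e e' k, (forall j, j < k -> e j = e' j) -> F e k = F e' k) ->
  exists e, forall k, e k = F e k.
Proof.
move=> loc; pose g := fix g m : real := if m is m'.+1 then F (g m') else (fun=> false).
have stab m m' j : j < m -> j < m' -> g m j = g m' j.
  elim/ltn_ind: j m m' => j IH [|m] [|m'] //= jm jm'; apply: loc => i ij.
  by apply: IH => //; apply: leq_trans ij _.
exists (fun k => g k.+1 k) => k /=; apply: loc => j jk; exact: (stab k j.+1).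
Qed.

(** A smaller entry meets its closing zero earlier, so comparing such rows block by block compares
    lists of equal length lexicographically. *)
Fixpoint unary (l : seq nat) : seq bool :=
  if l is a :: s then nseq a true ++ false :: unary s else [::].

(** Different lists of equal length share at most [size l - 1] closing zeros before they differ, and
    the allowance [h] covers these. *)
Lemma cmp_unary_tail l l' (f g : real) fuel t h : size l = size l' -> size l <= h.+1 ->
  lexlt l l' -> (forall i, f (t + i) = nth false (unary l) i) ->
  (forall i, g (t + i) = nth false (unary l') i) -> size (unary l) <= fuel ->
  cmp f g fuel t h true.
Proof.
elim: l l' fuel t h => [|a s IH] [|b s'] //= fuel t h [ss]; rewrite ltnS => sh.
elim: a b fuel t => [|a IHa] b fuel t lt fE gE; rewrite /= ?size_cat /= => sz.
  case: fuel sz => // fuel sz; have := fE 0; rewrite addn0 /= => ->.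
  have := gE 0; rewrite addn0; case: b lt gE => [|b] /= lt gE -> //.
  case: h sh => [|h] sh; first by move: lt ss; case: (s) sh.
  by apply: (IH s') => // i; rewrite addSnnS ?fE ?gE.
case: b lt gE => [|b] //= lt gE.
case: fuel sz => [|fuel] sz; first by lia.
have := fE 0; rewrite addn0 /= => ->; have := gE 0; rewrite addn0 /= => ->.
by apply: (IHa b) => [|i|i|]; rewrite ?addSnnS ?fE ?gE // size_cat /=; lia.
Qed.

(** The ones of the first entry build up the allowance that pays for the zeros to come; hence
    [size s <= t + a], with [t] ones already read. *)
Lemma cmp_unary a s b s' (f g : real) fuel t : lexlt (a :: s) (b :: s') ->
  (a = b -> size s = size s') -> size s <= t + a ->
  (forall i, f (t + i) = nth false (unary (a :: s)) i) ->
  (forall i, g (t + i) = nth false (unary (b :: s')) i) -> size (unary (a :: s)) <= fuel ->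
  cmp f g fuel t t false.
Proof.
elim: a b fuel t => [|a IHa] b fuel t lt ss st fE gE; rewrite /= ?size_cat /= => sz.
  case: fuel sz => // fuel sz /=; have := fE 0; rewrite addn0 /= => ->.
  have := gE 0; rewrite addn0; case: b lt ss gE => [|b] /= lt ss gE -> //.
  rewrite addn0 in st.
  have {}ss := ss erefl; case: t st fE gE => [|t] st fE gE; first by move: lt ss; case: (s) st.
  by apply: (@cmp_unary_tail s s') => // i; rewrite addSnnS ?fE ?gE.
case: b lt ss gE => [|b] //= lt ss gE.
case: fuel sz => [|fuel] sz /=; first by lia.
have := fE 0; rewrite addn0 /= => ->; have := gE 0; rewrite addn0 /= => ->.
apply: (IHa b) => [||||i|]; rewrite ?addSnnS ?fE ?gE //.
- by move=> e; apply: ss; rewrite e.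
- by move=> i; rewrite addSnnS fE.
- by rewrite /= size_cat /=; lia.
Qed.

Lemma lexlt_rcons a b c d : size a = size b ->
  lexlt (rcons a c) (rcons b d) = lexlt a b || (a == b) && (c < d).
Proof.
elim: a b => [|x a IH] [|y b] //=; first by rewrite andbF orbF.
by move=> [/IH ->]; rewrite eqseq_cons; case: ltngtP.
Qed.

(** * The circuit that simulates a program *)

Section Diagonal.
Variables (p : Prog) (n : nat).

Definition lit := (St p + nat + nat * nat)%type.
Definition litQ q : lit := inl (inl q).
Definition litH h : lit := inl (inr h).
Definition litT i k : lit := inr (i, k).

Definition litv (c : Config p) (l : lit) : bool :=
  match l with
  | inl (inl q) => cst c == q
  | inl (inr h) => chead c == h
  | inr (0, k) => tape1 c k
  | inr (1, k) => tape2 c k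
  | inr (_, k) => tape3 c k
  end.

Definition view := (St p * nat * (bool * bool * bool))%type.
Definition viewof (c : Config p) : view :=
  let h := chead c in (cst c, h, (tape1 c h, tape2 c h, tape3 c h)).

Definition litnext (w : view) (l : lit) (b : bool) : bool :=
  let: (q, h, bs) := w in
  if q == halt_st p then b else
  let: (q', (w1, w2, w3), mv) := delta q bs in
  match l with
  | inl (inl q'') => q' == q''
  | inl (inr h') => (if mv then h.+1 else h.-1) == h'
  | inr (i, k) => if k == h then match i with 0 => w1 | 1 => w2 | _ => w3 end else b
  end.

(** The next value of a literal depends on the view and its own present value only, hence on
    finitely many literals; this keeps the gates [Cn] local. *)
Lemma litv_step c l : litv (step c) l = litnext (viewof c) l (litv c l).
Proof.
rewrite /litnext /viewof /step; case: ifP => // _.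
by case: (delta _ _) => [[q' [[w1 w2] w3]] mv]; case: l => [[q|h]|[[|[|i]] k]].
Qed.

Definition tests (w : view) l b : seq (lit * bool) :=
  let: (q, h, (b1, b2, b3)) := w in
  [:: (litQ q, true); (litH h, true); (litT 0 h, b1); (litT 1 h, b2); (litT 2 h, b3); (l, b)].

Lemma testsP c w l b :
  (forall t, t \in tests w l b -> litv c t.1 = t.2) <-> w = viewof c /\ b = litv c l.
Proof.
case: w => [[q h] [[b1 b2] b3]]; split.
  move=> H; have := H (litQ q, true); rewrite !inE eqxx => /(_ isT)/eqP /= <-.
  have := H (litH h, true); rewrite !inE eqxx ?orbT => /(_ isT)/eqP /= <-.
  have := H (litT 0 h, b1); rewrite !inE eqxx ?orbT => /(_ isT) /= e1.
  have := H (litT 1 h, b2); rewrite !inE eqxx ?orbT => /(_ isT) /= e2.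
  have := H (litT 2 h, b3); rewrite !inE eqxx ?orbT => /(_ isT) /= e3.
  have := H (l, b); rewrite !inE eqxx ?orbT => /(_ isT) /= ->; split=> //.
  have := H (litH h, true); rewrite !inE eqxx ?orbT => /(_ isT)/eqP /= eh.
  by rewrite /viewof eh e1 e2 e3.
move=> [[-> -> -> -> ->] ->] t; rewrite !inE.
by do ![case/orP]; move/eqP=> -> //=; rewrite eqxx.
Qed.

(* Gates of stage [a], from the last to the first evaluated: [Zn a], the run
   accepts at [a]; [Cn a w l b], at [a] the machine has view [w] and [l] has
   value [b]; [Ln a l] and [NL a l], the literal [l] at [a] and its negation;
   [Fn a l], the limsup of [l] at [a]; [Dn a b l], [l] is false from [b] to [a]. *)
Inductive node :=
| Root
| One
| Zn of seq nat
| Cn of seq nat & view & lit & bool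
| Ln of seq nat & lit
| NL of seq nat & lit
| Fn of seq nat & lit
| Dn of seq nat & seq nat & lit.

Definition ncode (x : node) : nat :=
  pickle (match x with
  | Root => (0, 0)
  | One => (1, 0)
  | Zn a => (2, pickle a)
  | Cn a w l b => (3, pickle (a, w, l, b))
  | Ln a l => (4, pickle (a, l))
  | NL a l => (5, pickle (a, l))
  | Fn a l => (6, pickle (a, l))
  | Dn a b l => (7, pickle (a, b, l))
  end).

Lemma ncode_inj : injective ncode.
Proof.
move=> x y /(pcan_inj pickleK).
case: x => [||a|a w l b|a l|a l|a l|a b l]; case: y => [||a'|a' w' l' b'|a' l'|a' l'|a' l'|a' b' l'] //;
by case=> /(pcan_inj pickleK) ?; congruence.
Qed.

(** Gates are ordered by stage, then by kind. For stages of length [n] the leading entry is the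
    length of the rest, which grants the allowance that [cmp] needs. *)
Definition nlabel (x : node) : seq nat :=
  match x with
  | Root => n.+2 :: nseq n.+2 0
  | One => [:: 0]
  | Zn a => n.+1 :: rcons a 5
  | Cn a _ _ _ => n.+1 :: rcons a 4
  | Ln a _ => n.+1 :: rcons a 3
  | NL a _ => n.+1 :: rcons a 2
  | Fn a _ => n.+1 :: rcons a 1
  | Dn a _ _ => n.+1 :: rcons a 0
  end.

(* The weight makes [num x] exceed both the length of the label of [x], which
   is the number of positions inspected by [prec], and the index [k] of an input
   bit that the wires of [x] depend on. *)
Definition nweight x := size (unary (nlabel x)) + if x is NL _ (inr (_, k)) then k else 0.

Definition num x := if x is Root then 0 else (pr (ncode x) (nweight x)).+1.

Lemma num_inj : injective num.
Proof.
by case=> [||a|a w l b|a l|a l|a l|a b l]; case=> [||a'|a' w' l' b'|a' l'|a' l'|a' l'|a' b' l'] //;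
move=> [/pr_inj[/ncode_inj]].
Qed.

(** A true [y] makes [x] false. So [NL a l] is wired to the reasons for [l] to hold at [a], [Cn] and
    [Zn] to the failures of their conditions, and [Root] to acceptance at each stage. *)
Inductive edge (e : real) : node -> node -> Prop :=
| EdgeRoot a : size a = n -> edge e Root (Zn a)
| EdgeZq a : size a = n -> edge e (Zn a) (NL a (litQ (halt_st p)))
| EdgeZt a : size a = n -> edge e (Zn a) (NL a (litT 2 0))
| EdgeZg a g : size a = n -> size g = n -> lexlt g a -> edge e (Zn a) (Ln g (litQ (halt_st p)))
| EdgeC a w l b t : size a = n -> t \in tests w l b ->
    edge e (Cn a w l b) (if t.2 then NL a t.1 else Ln a t.1)
| EdgeL a l : size a = n -> edge e (Ln a l) (NL a l)
| EdgeN0 a l : size a = n -> is_zero a -> litv (init p e) l -> edge e (NL a l) One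
| EdgeNs a b w l c : size a = n -> size b = n -> a = incr_last b -> ~~ is_zero a ->
    ~~ is_limit a -> litnext w l c -> edge e (NL a l) (Cn b w l c)
| EdgeNq a l : size a = n -> is_limit a -> l \in [:: litQ (limit_st p); litH 0] ->
    edge e (NL a l) One
| EdgeNt a i k : size a = n -> is_limit a -> edge e (NL a (litT i k)) (Fn a (litT i k))
| EdgeF a b l : size a = n -> size b = n -> lexlt b a -> edge e (Fn a l) (Dn a b l)
| EdgeD a b g l : size a = n -> size b = n -> size g = n -> lexle b g -> lexlt g a ->
    edge e (Dn a b l) (Ln g l).

(** Only the wires for the initial tape consult [e], and [nweight] puts [num x] above the bit
    consulted. *)
Lemma edge_local e e' x y : (forall j, j < num x -> e j = e' j) -> edge e x y -> edge e' x y.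
Proof.
move=> ee E; case: E ee => {x y} [a sa|a sa|a sa|a g sa sg ga|a w l b t sa ht|a l sa
  |a l sa za hl|a b w l c sa sb ab nz nl hn|a l sa la hl|a i k sa la|a b l sa sb ba
  |a b g l sa sb sg bg ga] ee; try by constructor.
- apply: EdgeN0 => //; move: hl; case: l ee => [[q|h]|[[|[|i]] k]] //= ee.
  rewrite ee // /num ltnS /nweight; apply: leq_trans (pr_ger _ _); apply: leq_addl.
Qed.

(** Apart from wires out of [Root] or into [One], every wire leads to an earlier stage or to a lower
    kind at the same stage. The two size equations serve the allowance in [cmp_unary]. *)
Lemma edge_label e x y : edge e x y ->
  exists a s b s', [/\ nlabel y = a :: s, nlabel x = b :: s', lexlt (nlabel y) (nlabel x),
    size s = a & size s' = b].
Proof.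
have stage a c d : size a = n -> c < d ->
   exists x s b s', [/\ n.+1 :: rcons a c = x :: s, n.+1 :: rcons a d = b :: s',
     lexlt (n.+1 :: rcons a c) (n.+1 :: rcons a d), size s = x & size s' = b].
  move=> sa cd; exists n.+1, (rcons a c), n.+1, (rcons a d).
  by rewrite /= !size_rcons sa lexlt_rcons // !eqxx cd !orbT.
have stages a b c d : size a = n -> size b = n -> lexlt a b ->
   exists x s z s', [/\ n.+1 :: rcons a c = x :: s, n.+1 :: rcons b d = z :: s',
     lexlt (n.+1 :: rcons a c) (n.+1 :: rcons b d), size s = x & size s' = z].
  move=> sa sb ab; exists n.+1, (rcons a c), n.+1, (rcons b d).
  by rewrite /= !size_rcons sa sb lexlt_rcons ?sa ?sb // !eqxx ab !orbT.
have one a c : size a = n ->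
   exists x s z s', [/\ [:: 0] = x :: s, n.+1 :: rcons a c = z :: s',
     lexlt [:: 0] (n.+1 :: rcons a c), size s = x & size s' = z].
  by move=> sa; exists 0, [::], n.+1, (rcons a c); rewrite /= size_rcons sa.
case=> {x y} [a sa|a sa|a sa|a g sa sg ga|a w l b t sa ht|a l sa
  |a l sa za hl|a b w l c sa sb ab nz nl hn|a l sa la hl|a i k sa la|a b l sa sb ba
  |a b g l sa sb sg bg ga] /=; try by [apply: stage|apply: stages|apply: one].
- exists n.+1, (rcons a 5), n.+2, (nseq n.+2 0).
  by rewrite /= size_rcons size_nseq sa ltnSn.
- by case: t.2; apply: stage.
- apply: stages => //; rewrite ab; apply: lexlt_incr_last; apply/eqP => b0.
  by move: nz; rewrite ab b0.
Qed.

(* [described e] refers to [e] only through the initial tape; a code of the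
   circuit is a fixed point, which exists as only earlier bits are consulted. *)
Definition described (e : real) : real := fun k =>
  `[< exists x y, k = 10 * pr (num x) (num y) /\ edge e x y >] ||
  `[< exists x t, k = 10 * pr (num x) t + 1 /\ nth false (unary (nlabel x)) t >].

Lemma described_local e e' k : (forall j, j < k -> e j = e' j) -> described e k = described e' k.
Proof.
move=> ee; rewrite /described; congr (_ || _).
have H (d d' : real) : (forall j, j < k -> d j = d' j) ->
  `[< exists x y, k = 10 * pr (num x) (num y) /\ edge d x y >] ->
  `[< exists x y, k = 10 * pr (num x) (num y) /\ edge d' x y >].
  move=> dd /asboolP[x [y [kE E]]]; apply/asboolP; exists x, y; split=> //.
  apply: edge_local E => j jx; apply: dd; have := pr_gel (num x) (num y); lia.
by apply/idP/idP; apply: H => // j /ee.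
Qed.

(** * The valuation of the self-describing circuit *)

Section Value.
Variables (e : real) (v : nat -> bool) (r : seq nat -> Config p).
Hypotheses (eE : forall k, e k = described e k) (sv : solution e v) (R : run p e n r).

Lemma edgebitE x M : edgebit e (num x) M <-> exists2 y, M = num y & edge e x y.
Proof.
rewrite /edgebit eE; split.
  case/orP => /asboolP[x' [y [E h]]]; last by lia.
  have /pr_inj[/num_inj -> ->] : pr (num x) M = pr (num x') (num y) by lia.
  by exists y.
by move=> [y -> E]; apply/orP; left; apply/asboolP; exists x, y.
Qed.

Lemma labelE x t : label e (num x) t = nth false (unary (nlabel x)) t.
Proof.
rewrite /label eE; apply/idP/idP.
  case/orP => /asboolP[x' [y [E h]]]; first by lia.
  by have /pr_inj[/num_inj -> ->] : pr (num x) t = pr (num x') y by lia.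
by move=> h; apply/orP; right; apply/asboolP; exists x, t.
Qed.

Lemma prec_edge x y : edge e x y -> prec e (num y) (num x).
Proof.
(* The fuel is [num y], which is 0 only for [Root]; no wire leads there. *)
move=> E; have yR : y <> Root by case: (E) => // ? ? ? ? t *; case: t.2.
have [a [s [b [s' [ly lx lt sa sb]]]]] := edge_label E.
rewrite /prec; apply: (@cmp_unary a s b s').
- by rewrite -ly -lx.
- by rewrite sa sb.
- by rewrite sa.
- by move=> i; rewrite labelE ly.
- by move=> i; rewrite labelE lx.
- rewrite -ly; have : size (unary (nlabel y)) <= nweight y by apply: leq_addr.
  have := pr_ger (ncode y) (nweight y); case: (y) yR => //= *; lia.
Qed.

Definition nv x := v (num x).

(** All wires of this circuit descend, so the condition [prec] in [fires] filters nothing out. *)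
Lemma nvP x : nv x = true <-> forall y, edge e x y -> nv y = false.
Proof.
rewrite /nv (sv (num x)); split.
  move=> H y E; apply/negbTE/negP => vy; have := H (num y).
  by rewrite /fires vy prec_edge // andbT; move/negP; apply; apply/edgebitE; exists y.
move=> H M; apply/negP => /and3P[vM /edgebitE[y My E] _].
by move: vM; rewrite My (H y E).
Qed.

Lemma nv_false x y : edge e x y -> nv y = true -> nv x = false.
Proof. by move=> E vy; apply/negbTE/negP => /nvP/(_ _ E); rewrite vy. Qed.

Lemma nv_One : nv One = true.
Proof. by apply/nvP => y E; inversion E. Qed.

Lemma nv_Ln a l : size a = n -> nv (NL a l) = ~~ litv (r a) l -> nv (Ln a l) = litv (r a) l.
Proof.
move=> sa h; apply/idP/idP.
  by move/nvP/(_ _ (EdgeL e l sa)); rewrite h => /negbFE.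
by move=> lv; apply/nvP => y E; inversion E; rewrite h lv.
Qed.

Lemma nv_Cn a w l b : size a = n -> (forall l, nv (NL a l) = ~~ litv (r a) l) ->
  nv (Cn a w l b) = true <-> w = viewof (r a) /\ b = litv (r a) l.
Proof.
move=> sa H; rewrite -testsP nvP; split.
  move=> h t tt; have := h _ (EdgeC e sa tt); case: t tt => l' [] tt /=.
    by rewrite H => /negbFE.
  by rewrite nv_Ln.
move=> h y E; inversion E as [| | | |a' w' l' b' t sa' tt| | | | | | |]; subst.
have := h _ tt; case: t tt E => l' [] tt E /= lv; first by rewrite H lv.
by rewrite nv_Ln.
Qed.

Lemma edge_NL a l y : edge e (NL a l) y ->
  [\/ [/\ is_zero a, litv (init p e) l & y = One],
      exists b w c, [/\ size b = n, a = incr_last b, ~~ is_zero a && ~~ is_limit a &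
        litnext w l c /\ y = Cn b w l c],
      [/\ is_limit a, l \in [:: litQ (limit_st p); litH 0] & y = One] |
      exists i k, [/\ is_limit a, l = litT i k & y = Fn a l]].
Proof.
move Ex: (NL a l) => x E; case: E Ex => {x y} //.
- by move=> a' l' _ za hl [-> ->]; constructor 1.
- by move=> a' b w l' c _ sb ab nz nl hn [-> ->]; constructor 2; exists b, w, c; rewrite nz nl.
- by move=> a' l' _ la hl [-> ->]; constructor 3.
- by move=> a' i k _ la [-> ->]; constructor 4; exists i, k.
Qed.

Lemma litv_limit a i k : size a = n -> is_limit a ->
  litv (r a) (litT i k) = true <-> limsup_before n (fun g => litv (r g) (litT i k)) a.
Proof.
move=> sa la; have [_ _ zl] := R; have [_ _ /(_ k)[t1 [t2 t3]]] := zl a sa la.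
by case: i => [|[|i]].
Qed.

(** Two nested NOR gates over ranges of stages express the quantifiers of the limsup: [Fn a l]
    denies that [l] stays false from some [b] on. *)
Lemma nv_Fn a l : size a = n -> (forall b, size b = n -> lexlt b a ->
  forall l, nv (NL b l) = ~~ litv (r b) l) ->
  nv (Fn a l) = true <-> limsup_before n (fun g => litv (r g) l) a.
Proof.
move=> sa IH.
have D b : size b = n -> nv (Dn a b l) = true <->
    forall g, size g = n -> lexle b g -> lexlt g a -> litv (r g) l = false.
  move=> sb; rewrite nvP; split.
    by move=> H g sg bg ga; rewrite -nv_Ln ?IH //; apply: H; apply: EdgeD.
  move=> H y E; inversion E; subst; rewrite nv_Ln; [exact: H|by []|exact: IH].
rewrite nvP; split.
  move=> H b sb ba; have nD := H _ (EdgeF e l sa sb ba); apply: contrapT => no.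
  suff : nv (Dn a b l) = true by rewrite nD.
  by apply/D => // g sg bg ga; apply/negbTE/negP => lv; apply: no; exists g.
move=> H y E; inversion E as [| | | | | | | | | |a' b l' sa' sb ba|]; subst.
apply/negbTE/negP => /D; have [g [sg bg ga lv]] := H b sb ba.
by move/(_ sb g sg bg ga); rewrite lv.
Qed.

(** Transfinite induction on the stage: the wires of [NL a l] cover the initial value, the successor
    step and the limit rule, and one of them leads to a true gate iff [l] holds at [a]. *)
Lemma nv_NL a : size a = n -> forall l, nv (NL a l) = ~~ litv (r a) l.
Proof.
have [z0 zs zl] := R.
move: a; apply: lex_ind => a sa IH l.
case: (boolP (is_zero a)) => [za|nz].
  have nl : is_limit a = false by rewrite /is_limit za.
  rewrite z0 //; case lv : (litv _ l).
    by apply: (nv_false _ nv_One); apply: EdgeN0.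
  apply/nvP => y /edge_NL[[_]|[b [w [c [_ _]]]]|[]|[i [k []]]]; rewrite ?lv ?za ?nl //.
case: (boolP (is_limit a)) => [la|nl]; last first.
  have [b [sb aE a0 ba]] := stageP nz nl; rewrite sa in sb a0.
  have Hb := IH b sb ba.
  rewrite {2}aE zs // litv_step; case lv : (litnext _ _ _).
    apply: (@nv_false _ (Cn b (viewof (r b)) l (litv (r b) l))); last by apply/nv_Cn.
    by apply: EdgeNs lv.
  apply/nvP => y /edge_NL[[]|[b' [w [c [sb' aE' _ [hn ->]]]]]|[]|[i [k []]]];
    rewrite ?(negPf nz) ?(negPf nl) //.
  apply/negbTE/negP => /nv_Cn H; have b'a : lexlt b' a.
    rewrite aE'; apply: lexlt_incr_last; apply/eqP => b0; by move: nz; rewrite aE' b0.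
  have [|wE cE] := H sb'; first exact: IH.
  (* The predecessors [b] and [b'] of [a] need not be identified: a step from either leads to
     [r a]. *)
  move: hn; rewrite wE cE -litv_step -zs // -aE' aE zs // litv_step lv.
  by [].
(* At a limit, a state or head literal other than the two prescribed ones has no wires at all. *)
have only_one : ~~ litv (r a) l -> (l \notin [:: litQ (limit_st p); litH 0]) ->
    (forall i k, l <> litT i k) -> nv (NL a l) = true.
  move=> lv nin nT; apply/nvP => y /edge_NL[[]|[b [w [c [_ _]]]]|[_]|[i [k [_ /nT]]]] //.
  + by rewrite (negPf nz).
  + by rewrite la andbF.
  + by rewrite (negPf nin).
have [q h _] := zl a sa la.
case: l only_one => [[q'|h']|[i k]] only_one.
- rewrite /= q; case: eqP => [<-|ne] /=.
    by apply: (nv_false _ nv_One); apply: EdgeNq; rewrite ?inE ?eqxx.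
  apply: only_one => //=; first by rewrite q; apply/eqP.
  by rewrite !inE; apply/norP; split; apply/eqP => // -[E]; apply: ne.
- rewrite /= h; case: eqP => [<-|ne] /=.
    by apply: (nv_false _ nv_One); apply: EdgeNq; rewrite ?inE ?eqxx ?orbT.
  apply: only_one => //=; first by rewrite h; apply/eqP.
  by rewrite !inE; apply/norP; split; apply/eqP => // -[E]; apply: ne.
have F : nv (Fn a (litT i k)) = litv (r a) (litT i k).
  by apply/idP/idP => [/(nv_Fn _ sa IH)/litv_limit|/litv_limit H]; [|apply/(nv_Fn _ sa IH)]; auto.
case lv : (litv (r a) _) F => F.
  by apply: (nv_false _ F); apply: EdgeNt.
apply/nvP => y /edge_NL[[]|[b [w [c [_ _]]]]|[_]|[i' [k' [_ _ -> //]]]].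
+ by rewrite (negPf nz).
+ by rewrite la andbF.
+ by rewrite !inE.
Qed.

(** [Zn a] is true iff the run first halts at [a] and accepts; [Root], the NOR of these gates, is
    true iff the program rejects. *)
Lemma nv_Root b : HaltsWith p n e b -> nv Root = ~~ b.
Proof.
move=> H; have Z a : size a = n -> nv (Zn a) = true <->
   [/\ cst (r a) = halt_st p, tape3 (r a) 0 = true &
     forall g, size g = n -> lexlt g a -> cst (r g) <> halt_st p].
  move=> sa; rewrite nvP; split.
    move=> h; split.
    + by have := h _ (EdgeZq e sa); rewrite nv_NL // => /negbFE /= /eqP.
    + by have := h _ (EdgeZt e sa); rewrite nv_NL // => /negbFE.
    + move=> g sg ga; have := h _ (EdgeZg e sa sg ga); rewrite nv_Ln ?nv_NL //= => /eqP.
      by [].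
  move=> [hq ht hg] y E; inversion E as [|a' sa'|a' sa'|a' g sa' sg ga| | | | | | | |]; subst.
  + by rewrite nv_NL //= hq eqxx.
  + by rewrite nv_NL //= ht.
  + by rewrite nv_Ln ?nv_NL //=; apply/eqP; apply: hg.
have acc a : size a = n -> nv (Zn a) = true -> HaltsWith p n e true.
  by move=> sa /(Z _ sa)[hq ht hg]; exists r; split=> //; exists a.
case: b H => H.
  have [r' [R' [a [sa hq hg ht]]]] := H; have U := run_unique R' R.
  apply: (@nv_false _ (Zn a)); first exact: EdgeRoot.
  apply/Z => //; rewrite -U //; split=> // g sg ga; rewrite -U //; exact: hg.
apply/nvP => y E; inversion E as [a sa| | | | | | | | | | |]; subst.
by apply/negbTE/negP => /(acc _ sa)/(HaltsWith_unique H).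
Qed.

End Value.
End Diagonal.

(** A program deciding [output true] is run on the code [e] of its own circuit: its answer [b] must
    be the root value, which is [~~ b]. *)
Lemma output_notP : ~ inP (output true).
Proof.
move=> [p [n H]]; have [e eE] := local_fixpoint (@described_local p n).
have [v sv] := solution_exists e; have [b [Hb bA]] := H e.
have [r [R _]] := Hb; have vR := nv_Root eE sv R Hb.
have : b = true <-> v 0 = true.
  rewrite bA; split; last by exists v.
  by move=> [w sw <-]; apply: solution_unique sv sw 0.
(* [num Root] is 0, so [nv_Root] speaks about [v 0]. *)
have -> : v 0 = ~~ b by exact: vR.
by case: b {Hb bA vR} => -[h1 h2]; [have := h1 erefl|have := h2 erefl].
Qed.

Theorem mainTheorem4 :
  ~ (forall A : real -> Prop, inP A <-> (inNP A /\ incoNP A)) /\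
  ~ (forall A : real -> Prop, inP A <-> inNP A).
Proof.
split=> H; apply: output_notP; apply/H; last exact: output_NP.
by split; [exact: output_NP|exact: output_coNP].
Qed.
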